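(* Let $E$ be a reflexive real Banach space, $B$ the open unit ball of $E$ centered at $0$, and $a<b$ real numbers. Assume: (A) $A\colon D(A)\subset E\to E$ is a linear, not necessarily bounded, operator which generates a compact $C_0$-semigroup of contractions $S\colon[0,\infty)\to\mathcal{L}(E)$; (f) $f\colon[a,b]\times E\to E$ is continuous, and for every bounded $\Omega\subset E$ there is $\nu_\Omega\in L^1([a,b])$ such that $\Vert f(t,x)\Vert\le\nu_\Omega(t)$ for a.a. $t\in[a,b]$ and all $x\in\Omega$; and let $M\colon C([a,b],E)\to E$ satisfy: (m$_0$) there is a constant $r>0$ such that $M(C([a,b],r\overline B))\subseteq r\overline B$; (m$_1$) if $\{x_n\}\subset C([a,b],r\overline B)$, $x\in C([a,b],E)$ and $x_n(t)\to x(t)$ for every $t\in(a,b]$, then $M(x_n)\to M(x)$ as $n\to\infty$. Suppose there exists a locally Lipschitzian bounding function $V\colon E\to\mathbb{R}$ for the equation $x'(t)=Ax(t)+f(t,x(t))$, $t\in[a,b]$, with $K:=rB$ and $r$ as in (m$_0$). Then the problem $$x'(t)=Ax(t)+f(t,x(t)),\ t\in[a,b],\qquad x(a)=M(x),$$ admits at least one mild solution $x\in C([a,b],r\overline B)$.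
   Context: A $C_0$-semigroup $\{S(t)\}_{t\ge0}$ is called compact if $S(t)$ is a compact operator for every $t>0$; it is a contraction semigroup if $\Vert S(t)\Vert\le1$ for all $t\ge0$. $C([a,b],r\overline B)$ denotes the set of continuous functions $[a,b]\to E$ with values in the closed ball $r\overline B$. Mild solution: a function $x\in C([a,b],E)$ is a mild solution of $x'=Ax+f(t,x)$ if $x(t)=S(t-a)x(a)+\int_a^tS(t-s)f(s,x(s))\,ds$ for $t\in[a,b]$; it is a mild solution of the problem if moreover $x(a)=M(x)$. Bounding function: let $K\subset E$ be nonempty, open and bounded. A function $V\colon E\to\mathbb{R}$ is a bounding function (with respect to $K$) for the equation $x'=Ax+f(t,x)$ if (V1) $V=0$ on $\partial K$ and $V\le0$ on $K$; (V2) $\liminf_{h\to0^-}\frac{V(x+hf(t,x))}{h}<0$ for all $t\in(a,b]$ and $x\in\partial K$. *)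

(* Defs.v *)
From HB Require Import structures.
From mathcomp Require Import all_boot all_order all_algebra.
From mathcomp Require Import all_classical all_reals all_analysis.
Import Order.TTheory GRing.Theory Num.Theory.
Import numFieldNormedType.Exports.

Set Implicit Arguments.
Unset Strict Implicit.
Unset Printing Implicit Defensive.

Local Open Scope classical_set_scope.
Local Open Scope ring_scope.

Definition opnorm (R : realType) (E F : normedModType R) (T : E -> F) : \bar R :=
  ereal_sup [set (`|T x|)%:E | x in [set x : E | `|x| <= 1]].

Definition dual (R : realType) (E : normedModType R) : set (E -> R^o) :=
  [set phi | linear phi /\ continuous phi].

Definition bidual (R : realType) (E : normedModType R)
    (Phi : (E -> R^o) -> R) : Prop :=
  (forall (c : R) (phi psi : E -> R^o), dual phi -> dual psi ->
     Phi (fun x => c *: phi x + psi x) = c * Phi phi + Phi psi) /\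
  (exists C : R, forall phi : E -> R^o, dual phi ->
     ((`|Phi phi|)%:E <= C%:E * opnorm phi)%E).

(* The canonical embedding of E into its bidual is onto. *)
Definition reflexive_space (R : realType) (E : normedModType R) : Prop :=
  forall Phi : (E -> R^o) -> R, bidual Phi ->
    exists x : E, forall phi : E -> R^o, dual phi -> Phi phi = phi x.

Definition compact_operator (R : realType) (E F : normedModType R)
    (T : E -> F) : Prop :=
  forall B : set E, bounded_set B -> precompact (T @` B).

(* A semigroup is indexed by all of R, but only its values at t >= 0 are ever
   constrained or used. *)
Definition C0_semigroup (R : realType) (E : normedModType R)
    (S : R -> {linear E -> E}) : Prop :=
  [/\ forall t, 0 <= t -> continuous (S t),
      forall x, S 0 x = x,
      forall s t x, 0 <= s -> 0 <= t -> S (s + t) x = S s (S t x) &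
      forall x, S t x @[t --> 0^'+] --> x].

Definition compact_semigroup (R : realType) (E : normedModType R)
    (S : R -> {linear E -> E}) : Prop :=
  forall t, 0 < t -> compact_operator (S t).

Definition contraction_semigroup (R : realType) (E : normedModType R)
    (S : R -> {linear E -> E}) : Prop :=
  forall t, 0 <= t -> (opnorm (S t) <= 1)%E.

(* An unbounded operator with domain D is a total map, irrelevant off D. *)
Definition linear_on (R : realType) (E : normedModType R)
    (D : set E) (A : E -> E) : Prop :=
  D 0 /\ forall (c : R) x y, D x -> D y ->
    D (c *: x + y) /\ A (c *: x + y) = c *: A x + A y.

Definition generates (R : realType) (E : normedModType R)
    (D : set E) (A : E -> E) (S : R -> {linear E -> E}) : Prop :=
  forall x y, (D x /\ A x = y) <->
    (h^-1 *: (S h x - x) @[h --> 0^'+] --> y).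

(* Data of the simple function \sum_i c_i 1_(A_i). *)
Record simple_data (R : realType) (E : normedModType R) := SimpleData {
  simple_size : nat ;
  simple_set : 'I_simple_size -> set R ;
  simple_coef : 'I_simple_size -> E }.

Arguments simple_set {R E} s i.
Arguments simple_coef {R E} s i.

Definition simple_on (R : realType) (E : normedModType R)
    (D : set R) (s : simple_data E) : Prop :=
  forall i, [/\ measurable (simple_set s i), simple_set s i `<=` D &
    (lebesgue_measure (simple_set s i) < +oo)%E].

Definition simple_val (R : realType) (E : normedModType R)
    (s : simple_data E) (t : R) : E :=
  \sum_i \1_(simple_set s i) t *: simple_coef s i.

Definition simple_int (R : realType) (E : normedModType R)
    (s : simple_data E) : E :=
  \sum_i fine (lebesgue_measure (simple_set s i)) *: simple_coef s i.

(* g is Bochner integrable on D for the Lebesgue measure, with integral v. *)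
Definition bochner_integral (R : realType) (E : normedModType R)
    (D : set R) (g : R -> E) (v : E) : Prop :=
  exists s : nat -> simple_data E,
    [/\ forall n, simple_on D (s n),
        {ae lebesgue_measure, forall t, D t ->
           simple_val (s n) t @[n --> \oo] --> g t},
        (\int[lebesgue_measure]_(t in D) (`|g t - simple_val (s n) t|)%:E)%E
           @[n --> \oo] --> 0%E &
        simple_int (s n) @[n --> \oo] --> v].

(* Elements of C([a, b], E) are maps on R, considered on [a, b] only. *)
Definition Cab (R : realType) (E : normedModType R) (a b : R) : set (R -> E) :=
  [set x | {within `[a, b], continuous x}].

Definition Cab_ball (R : realType) (E : normedModType R) (a b r : R) :
    set (R -> E) :=
  [set x | Cab a b x /\ forall t, t \in `[a, b] -> `|x t| <= r].

Definition mild_solution (R : realType) (E : normedModType R)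
    (S : R -> {linear E -> E}) (f : R -> E -> E) (a b : R) (x : R -> E) : Prop :=
  Cab a b x /\ forall t, t \in `[a, b] ->
    exists2 v : E, bochner_integral `[a, t] (fun s => S (t - s) (f s (x s))) v &
      x t = S (t - a) (x a) + v.

Definition L1_dominated (R : realType) (E : normedModType R)
    (a b : R) (f : R -> E -> E) : Prop :=
  forall Omega : set E, bounded_set Omega -> exists2 nu : R -> R,
    lebesgue_measure.-integrable `[a, b] (EFin \o nu) &
    {ae lebesgue_measure, forall t, t \in `[a, b] ->
       forall x, Omega x -> `|f t x| <= nu t}.

Definition boundary (T : topologicalType) (K : set T) : set T :=
  closure K `\` K°.

Definition bounding_function (R : realType) (E : normedModType R)
    (f : R -> E -> E) (a b : R) (K : set E) (V : E -> R) : Prop :=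
  [/\ [/\ K !=set0, open K & bounded_set K],
      (forall x, boundary K x -> V x = 0) /\ (forall x, K x -> V x <= 0) &
      forall t x, t \in `]a, b] -> boundary K x ->
        (limf_einf (fun h : R => (V (x + h *: f t x) / h)%:E) 0^'- < 0)%E].

Definition locally_lipschitz (R : realType) (E F : normedModType R)
    (V : E -> F) : Prop :=
  forall x : E, exists2 U : set E, nbhs x U & [lipschitz V y | y in U].

(* Main.v *)
Require Import Defs.
From HB Require Import structures.
From mathcomp Require Import all_boot all_order all_algebra.
From mathcomp Require Import all_classical all_reals all_analysis.
From mathcomp Require Import measurable_realfun ring lra.
Import Order.TTheory GRing.Theory Num.Theory.
Import numFieldNormedType.Exports.

(** The truncated problem.  Let pi be the radial retraction of E onto the closed
    ball of radius r, and replace f by F(s, x) = f(s, pi x) and M by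
    N(z) = M(pi o z).  Now F is dominated by one integrable function nu, uniformly
    in x, and N takes values in the ball, so the mild formulation
    z(t) = S(t - a) N(z) + \int_a^t S(t - s) F(s, z(s)) ds
    makes sense for all continuous z.  It suffices to solve it and to show that
    every solution stays in the ball, where pi is the identity.

    Why solutions stay in the ball ([mild_norm_bound]).  Outside the
    ball and close to a point x of the sphere, V is at most a constant times
    |.| - r, since it vanishes on the sphere; so the condition on the lower limit
    of V(x + h f(t, x)) / h at 0- says, after
    using the convexity of the norm, that |x - k f(t, x)| >= r + c k for some c > 0
    and all k > 0 ([bounding_function_outward]).  If |z| had a maximum larger than r
    on [a, b], it would be attained at some t > a because |N(z)| <= r, and there
    |z(t - k)| >= |S(k) z(t - k)| >= |z(t) - k F(t, z(t))| - o(k)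
    >= |z(t)| + c k - o(k) > |z(t)| for small k: a contradiction.

    Solving the truncated problem ([truncated_problem]).  For n >= 1 let Z_n(w)
    solve the equation with initial value w and with F evaluated at a delayed time,
    with delay (b - a) / n.  It is obtained in n explicit steps, and by dominated
    convergence it depends continuously on w, pointwise in time.  The map sending w
    to S(1/n) N(Z_n(w)) is continuous on E with precompact range because S(1/n) is
    compact, hence it has a fixed point w_n up to an error 1/n, by Schauder's
    argument, applied in E itself rather than in a space of functions.
    Finally n tends to infinity.  The integral terms of z_n = Z_n(w_n) are
    equicontinuous on [a, b] and pointwise precompact, again because S(h) is compact
    for h > 0.  The vectors v_n = N(z_n) are merely bounded, but E is reflexive: they
    converge weakly along an ultrafilter to some w_0, and then S(s) v_n converges in
    norm to S(s) w_0 for every s > 0 ([mild_compactness]).  Thus a subsequence of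
    z_n converges pointwise on (a, b] to a function that extends continuously to a
    with value w_0, and this is exactly the convergence under which N is continuous.
    So v_n converges to N of the limit, w_0 = N of the limit, and dominated
    convergence identifies the integral term.

    Tools.  Brouwer's theorem is proved on the standard simplex with the dominant
    pairs of Scarf, in the form due to Petri and Voorneveld
    ([dominant_coloring], [brouwer_simplex]): instead of a
    triangulation, it uses the grid points with one linear order per coordinate.
    Vector-valued integrals are weak (Pettis) integrals: for continuous u the functional
    phi |-> \int phi(u) lies in the bidual, so reflexivity provides the integral
    ([vintP]), and uniform approximation by step functions shows that it is also
    the Bochner integral ([vint_bochner]).  The Hahn-Banach theorem is used through
    norming functionals ([norming_functional]). *)

Set Implicit Arguments.
Unset Strict Implicit.
Unset Printing Implicit Defensive.

(** * Dominant pairs and colorings *)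

Section DominantColorings.
Import boot.finset.

(** A surjection onto a set with one element less identifies exactly one pair of
    points, and the two points of this pair are the only ones that can be dropped
    without losing surjectivity. *)
Lemma card_redundant (A B : finType) (f : A -> B) (D : {set A}) (T : {set B}) :
  f @: D = T -> #|D| = #|T|.+1 -> #|[set k in D | f @: (D :\ k) == T]| = 2.
Proof.
move=> fD cD.
have /dinjectivePn[i iD [j]] : ~~ dinjectiveb f (mem D).
  apply/negP => /dinjectiveP /card_in_imset; rewrite fD cD => e.
  by have := ltnn #|T|; rewrite {2}e leqnn.
rewrite !inE => /andP[ji jD] fij.
have injD : {in D :\ i &, injective f}.
  apply/imset_injP.
  have -> : f @: (D :\ i) = T.
    apply/setP => y; rewrite -fD; apply/imsetP/imsetP => -[k].
      by rewrite !inE => /andP[_ kD] ->; exists k.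
    move=> kD ->; have [->|ki] := eqVneq k i; last by exists k => //; rewrite !inE ki.
    by exists j; rewrite // !inE ji.
  by have := cardsD1 i D; rewrite iD cD add1n => -[<-].
suff -> : [set k in D | f @: (D :\ k) == T] = [set i; j].
  by rewrite cards2 eq_sym ji.
have sym u v : u \in D -> v \in D -> u != v -> f u = f v -> f @: (D :\ u) == T.
  move=> uD vD uv fuv; apply/eqP/setP => y; rewrite -fD.
  apply/imsetP/imsetP => -[k]; first by rewrite !inE => /andP[_ kD] ->; exists k.
  move=> kD ->; have [->|ku] := eqVneq k u; last by exists k => //; rewrite !inE ku.
  by exists v; rewrite // !inE eq_sym uv.
apply/setP => k; rewrite !inE; apply/andP/orP => [[kD /eqP fk]|]; last first.
  by case=> /eqP ->; split=> //; [apply: (sym i j)|apply: (sym j i)] => //;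
     rewrite eq_sym.
have [->|ki] := eqVneq k i; first by left.
have : f k \in f @: (D :\ k) by rewrite fk -fD imset_f.
case/imsetP=> k'; rewrite !inE => /andP[kk' k'D] e; right.
have [k'i|k'i] := eqVneq k' i.
  by apply/eqP/injD; rewrite ?inE ?ki ?ji // e k'i.
by move: kk'; rewrite (injD k k') ?inE ?ki ?k'i ?eqxx.
Qed.

Section Dominance.
Variables (I X : finType) (key : I -> X -> nat) (c : X -> I) (x0 : X).
Hypothesis key_inj : forall i, injective (key i).
Implicit Types (T : {set X}) (C : {set I}).

Definition lowest i T x := [forall t in T, key i x <= key i t].
(** No point of [X] lies strictly above the [i]-minimum of [T] for all [i] in [C]
    at once.  These are the primitive sets of Scarf. *)
Definition dominant T C := [forall x, exists i in C, lowest i T x].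

Definition low T i := [arg min_(t < odflt x0 [pick t in T] in T) key i t].

Lemma lowP T i : T != set0 -> low T i \in T /\ lowest i T (low T i).
Proof.
move=> T0; rewrite /low; case: arg_minnP => [|t tT tmin].
  by case: pickP => [//|e]; case/set0Pn: T0 => x; rewrite e.
by split=> //; apply/forall_inP.
Qed.

Lemma lowestE T i t : t \in T -> lowest i T t = (t == low T i).
Proof.
move=> tT; have T0 : T != set0 by apply/set0Pn; exists t.
have [lT lm] := lowP i T0; apply/idP/eqP => [/forall_inP tm|-> //].
apply: (@key_inj i); apply/eqP; rewrite eqn_leq tm //.
by move/forall_inP : lm => ->.
Qed.

(** A member of [T] that is the [i]-minimum for no [i] in [C] would lie strictly
    above all these minima.  In particular [#|T| <= #|C|]. *)
Lemma dominant_low T C : T != set0 -> dominant T C -> low T @: C = T.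
Proof.
move=> T0 /forallP d; apply/setP => t; apply/imsetP/idP => [[i iC ->]|tT].
  by have [] := lowP i T0.
have /exists_inP[i iC] := d t; rewrite lowestE // => /eqP ->; by exists i.
Qed.

Lemma dominantD1 T C x : dominant T C -> dominant (T :\ x) C.
Proof.
move=> /forallP d; apply/forallP => y; have /exists_inP[i iC /forall_inP l] := d y.
apply/exists_inP; exists i => //; apply/forall_inP => t; rewrite inE => /andP[_].
exact: l.
Qed.

Lemma dominantU1 T C i : dominant T C -> dominant T (i |: C).
Proof.
move=> /forallP d; apply/forallP => y; have /exists_inP[j jC l] := d y.
by apply/exists_inP; exists j => //; rewrite inE jC orbT.
Qed.

Section Pivot.
Variables (T : {set X}) (C : {set I}).
Hypothesis domTC : dominant T C.
Hypothesis cardTC : #|C| = #|T|.+1.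

(** The points that can be added to [T] so that they become its [k]-minimum. *)
Definition entering k := [set x | [&& x \notin T, dominant (x |: T) C & lowest k T x]].

Lemma low_entering x : x \notin T -> dominant (x |: T) C ->
  {in C &, injective (low (x |: T))}.
Proof.
move=> xT d; apply/imset_injP; rewrite dominant_low //; last first.
  by apply/set0Pn; exists x; rewrite !inE eqxx.
by rewrite cardsU1 xT cardTC.
Qed.

Lemma lowestU1 x i : lowest i T x = lowest i (x |: T) x.
Proof.
apply/forall_inP/forall_inP => l t; last by move=> tT; apply: l; rewrite inE tT orbT.
by rewrite !inE => /orP[/eqP -> //|]; exact: l.
Qed.

Lemma entering_uniq x k k' : x \notin T -> dominant (x |: T) C ->
  k \in C -> k' \in C -> lowest k T x -> lowest k' T x -> k = k'.
Proof.
move=> xT d kC k'C; rewrite !lowestU1 !lowestE ?inE ?eqxx //.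
move=> /eqP e /eqP e'; apply: (low_entering xT d) => //; by rewrite -e.
Qed.

(** If [T] is still covered by the minima for [C :\ k], there is exactly one pivot
    through [k]: either [k] can be dropped, or some points beat [T] for all other
    indices, and then the [k]-largest of these is the only one that can enter. *)
Lemma pivot_covered k : k \in C ->
  [forall t in T, exists i in C :\ k, lowest i T t] ->
  #|entering k| + dominant T (C :\ k) = 1.
Proof.
move=> kC cov; have [dk|ndk] := boolP (dominant T (C :\ k)).
  suff -> : entering k = set0 by rewrite cards0.
  apply/setP => x; rewrite !inE; apply/negbTE/negP => /and3P[xT d l].
  have /exists_inP[k'] := forallP dk x.
  rewrite !inE => /andP[k'k k'C] l'.
  by move: k'k; rewrite (entering_uniq xT d k'C kC l' l) eqxx.
(* The candidates for entering when k cannot be dropped. *)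
pose beats x := [forall i in C :\ k, ~~ lowest i T x].
have [w wW] : exists w, beats w.
  move: ndk; rewrite negb_forall => /existsP[w]; rewrite negb_exists_in => H.
  by exists w.
have lowW x : beats x -> lowest k T x.
  move=> /forall_inP bx; have /exists_inP[i iC li] := forallP domTC x.
  have [<- //|ik] := eqVneq i k.
  by have := bx i; rewrite !inE ik iC li => /(_ isT).
have TW x : beats x -> x \notin T.
  move=> /forall_inP bx; apply/negP => /(forall_inP cov) /exists_inP[i iC li].
  by move: (bx _ iC); rewrite li.
case: (@arg_maxnP X w beats (key k) wW) => x bx xmax0.
have xmax y : beats y -> key k y <= key k x := @xmax0 y.
suff -> : entering k = [set x] by rewrite cards1.
have bT y i : beats y -> i \in C :\ k -> exists2 t, t \in T & key i t < key i y.
  move=> /forall_inP b /b; rewrite negb_forall_in => /exists_inP[t tT].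
  by rewrite -ltnNge; exists t.
apply/setP => y; rewrite !inE; apply/and3P/eqP => [[yT dy ly]|->].
  have byy : beats y.
    apply/forall_inP => i; rewrite !inE => /andP[ik iC]; apply/negP => li.
    by move: ik; rewrite (entering_uniq yT dy iC kC li ly) eqxx.
  apply: (@key_inj k); apply/eqP; rewrite eqn_leq xmax //=.
  have /exists_inP[i iC /forall_inP li] := forallP dy x.
  have [<-|ik] := eqVneq i k; first by apply: li; rewrite !inE eqxx.
  have [|t tT] := bT x i bx; first by rewrite !inE ik.
  by rewrite ltnNge li // inE tT orbT.
split; [exact: TW | | exact: lowW].
apply/forallP => z; apply/exists_inP.
have [bz|] := boolP (beats z).
  exists k => //; apply/forall_inP => t; rewrite !inE => /orP[/eqP ->|tT].
    exact: xmax.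
  exact: (forall_inP (lowW _ bz)).
rewrite negb_forall_in => /exists_inP[i ik]; rewrite negbK => /forall_inP li.
have iC : i \in C by move: ik; rewrite inE => /andP[].
exists i => //; apply/forall_inP => t; rewrite !inE => /orP[/eqP ->|]; last exact: li.
have [u uT /ltnW ux] := bT _ _ bx ik.
apply: leq_trans ux; exact: li.
Qed.

(** If [k] is the only index whose minimum is a given point of [T], this point
    would dominate after dropping [k], and would be no minimum at all once the
    [k]-minimum is a new point. *)
Lemma pivot_uncovered k : k \in C -> T != set0 ->
  ~~ [forall t in T, exists i in C :\ k, lowest i T t] ->
  #|entering k| + dominant T (C :\ k) = 0.
Proof.
move=> kC T0 ncov.
have -> : dominant T (C :\ k) = false.
  apply: contraNF ncov => /forallP d; apply/forall_inP => t _; exact: d.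
rewrite addn0; apply/eqP; rewrite cards_eq0; apply: contraR ncov.
case/set0Pn => x; rewrite inE => /and3P[xT d lx].
apply/forall_inP => t tT.
have : t \in low (x |: T) @: C.
  by rewrite dominant_low ?inE ?tT ?orbT //; apply/set0Pn; exists x; rewrite !inE eqxx.
case/imsetP => i iC e; apply/exists_inP; exists i.
  rewrite !inE iC andbT; apply: contraNneq xT => ik.
  move: lx; rewrite lowestU1 lowestE ?inE ?eqxx // -ik -e => /eqP ->//.
apply/forall_inP => u uT.
have : t == low (x |: T) i by rewrite e.
by rewrite -lowestE ?inE ?tT ?orbT // => /forall_inP; apply; rewrite inE uT orbT.
Qed.

(** By [pivot_covered] and [pivot_uncovered] the pivots are counted by the indices
    that can be spared in covering [T]; by [card_redundant] there are two of them,
    except that for empty [T] the single index of [C] is one. *)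
Lemma odd_degree_deficient :
  odd (#|[set x | (x \notin T) && dominant (x |: T) C]| +
       #|[set k in C | dominant T (C :\ k)]|) = (T == set0).
Proof.
have -> : #|[set x | (x \notin T) && dominant (x |: T) C]| =
          \sum_(k in C) #|entering k|.
  transitivity (\sum_(x | (x \notin T) && dominant (x |: T) C)
                 \sum_(k in C) (lowest k T x : nat)).
    rewrite -sum1_card; apply: eq_big => [x|x]; first by rewrite inE.
    rewrite inE => /andP[xT d].
    have : x \in low (x |: T) @: C.
      by rewrite dominant_low ?inE ?eqxx //; apply/set0Pn; exists x; rewrite !inE eqxx.
    case/imsetP => i iC e.
    have li : lowest i T x by rewrite lowestU1 lowestE ?inE ?eqxx //; apply/eqP.
    rewrite (bigD1 i) //= li big1 // => k /andP[kC ki].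
    apply/eqP; rewrite eqb0; apply: contra ki => lk; apply/eqP.
    exact: entering_uniq lk li.
  rewrite exchange_big; apply: eq_bigr => k kC /=.
  rewrite -sum1_card big_mkcond [RHS]big_mkcond /=; apply: eq_bigr => x _.
  by rewrite inE andbA; case: (_ && _); case: lowest.
have -> : #|[set k in C | dominant T (C :\ k)]| =
          \sum_(k in C) (dominant T (C :\ k) : nat).
  rewrite -sum1_card (eq_bigl (fun k => (k \in C) && dominant T (C :\ k))).
    by rewrite -big_mkcondr; apply: eq_bigr.
  by move=> k; rewrite inE.
rewrite -big_split /=.
have [T0|T0] := eqVneq T set0.
  have /eqP/cards1P[k Ck] : #|C| = 1 by rewrite cardTC T0 cards0.
  rewrite {1}Ck big_set1 pivot_covered ?Ck ?inE ?eqxx //.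
  by apply/forall_inP => t; rewrite T0 inE.
rewrite (eq_bigr (fun k => (low T @: (C :\ k) == T) : nat)).
  have := card_redundant (dominant_low T0 domTC) cardTC.
  rewrite -sum1_card (eq_bigl (fun k => (k \in C) && (low T @: (C :\ k) == T))).
    by rewrite big_mkcondr /= => ->.
  by move=> k; rewrite inE.
move=> k kC.
have <- : [forall t in T, exists i in C :\ k, lowest i T t] = (low T @: (C :\ k) == T).
  apply/idP/eqP => [/forall_inP cov|e].
    apply/setP => t; apply/imsetP/idP => [[i iC ->]|tT]; first by have [] := lowP i T0.
    have /exists_inP[i iC] := cov _ tT; rewrite lowestE // => /eqP ->; by exists i.
  apply/forall_inP => t tT.
  move: (tT); rewrite -{1}e => /imsetP[i iC ti]; apply/exists_inP; exists i => //.
  by rewrite lowestE // ti.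
have [cov|ncov] := boolP [forall t in T, exists i in C :\ k, lowest i T t].
  by rewrite pivot_covered.
by rewrite pivot_uncovered.
Qed.

End Pivot.

Section Parity.
Variable n : I.

(** The two sides of a bipartite graph: [deficient] pairs miss the color [n], and
    become [balanced] by adding a point or dropping an index.  Following the edges
    is the path argument of Sperner's lemma; parity of degrees replaces paths. *)
Definition balanced T C := dominant T C && (#|T| == #|C|).
Definition deficient T C :=
  [&& dominant T C, n \in C, #|C| == #|T|.+1 & c @: T == C :\ n].

(** Going back to a deficient pair means deleting a point or adding an index so
    that the colors are those of [C] other than [n].  There is one way when the
    colors are exactly those of [C], and otherwise none or two: the two points of
    equal color, or the point of the foreign color and that color itself. *)
Lemma odd_degree_balanced T C : balanced T C ->
  odd (#|[set x in T | deficient (T :\ x) C]| + #|[set k | (k \notin C) && deficient T (k |: C)]|)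
  = (c @: T == C).
Proof.
case/andP => d /eqP cTC.
have -> : [set x in T | deficient (T :\ x) C] =
          [set x in T | (n \in C) && (c @: (T :\ x) == C :\ n)].
  apply/setP => x; rewrite !inE; case xT : (x \in T) => //=.
  by rewrite /deficient dominantD1 // -cTC (cardsD1 x T) xT add1n eqxx.
have -> : [set k | (k \notin C) && deficient T (k |: C)] =
          [set k | [&& k \notin C, n \in k |: C & c @: T == (k |: C) :\ n]].
  apply/setP => k; rewrite !inE /deficient dominantU1 //= cardsU1.
  by case kC : (k \in C) => //=; rewrite cTC add1n eqxx /= !inE.
have [nC|nC] := boolP (n \in C); last first.
  rewrite (_ : [set x in T | _] = set0) ?cards0 ?add0n; last first.
    by apply/setP => x; rewrite !inE andbF.
  have e k : k \notin C -> n \in k |: C -> k = n.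
    by move=> kC; rewrite !inE (negbTE nC) orbF => /eqP.
  have [cT|cT] := eqVneq (c @: T) C.
    rewrite (_ : [set k | _] = [set n]) ?cards1 //.
    apply/setP => k; rewrite !inE; apply/and3P/eqP => [[kC nk _]|->].
      by apply: e; rewrite // !inE.
    by rewrite nC eqxx setU1K ?cT.
  rewrite (_ : [set k | _] = set0) ?cards0 //.
  apply/setP => k; rewrite !inE; apply/and3P => -[kC nk].
  have -> := e k kC _; first by rewrite setU1K // (negbTE cT).
  by rewrite !inE.
have inC k : (n \in k |: C) by rewrite !inE nC orbT.
have -> : [set x in T | true && (c @: (T :\ x) == C :\ n)] =
          [set x in T | c @: (T :\ x) == C :\ n] by [].
have -> : [set k | [&& k \notin C, n \in k |: C & c @: T == (k |: C) :\ n]] =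
          [set k | (k \notin C) && (c @: T == k |: (C :\ n))].
  apply/setP => k; rewrite !inE nC orbT /=; case kC : (k \in C) => //=.
  congr (_ == _); apply/setP => i; rewrite !inE.
  have [->|//] := eqVneq i k; rewrite /= andbT; apply/idP.
  by apply: contraFneq kC => ->.
have cardCn : #|C| = #|C :\ n|.+1 by rewrite (cardsD1 n C) nC.
have only x : x \in T -> c @: (T :\ x) = C :\ n -> c @: T = c x |: (C :\ n).
  by move=> xT <-; rewrite -{1}(setD1K xT) imsetU1.
have unique k : c @: T = k |: (C :\ n) -> k \notin C :\ n ->
    #|[set x in T | c @: (T :\ x) == C :\ n]| = 1.
  move=> e kC.
  have inj : {in T &, injective c}.
    by apply/imset_injP; rewrite e cardsU1 kC cTC cardCn.
  have : k \in c @: T by rewrite e !inE eqxx.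
  case/imsetP => x xT kx.
  rewrite (_ : [set _ in _ | _] = [set x]) ?cards1 //.
  apply/setP => y; rewrite !inE; apply/andP/eqP => [[yT /eqP ey]|->].
    apply: inj => //; rewrite -kx; apply/eqP; move: kC; apply: contraR => cyk.
    rewrite -ey kx; apply: imset_f; rewrite !inE xT andbT.
    by apply: contraNneq cyk => <-; rewrite kx.
  split=> //; apply/eqP/setP => i; apply/imsetP/idP => [[z]|iC].
    rewrite !inE => /andP[zx zT] ->.
    have : c z \in c @: T by rewrite imset_f.
    rewrite e !inE => /orP[/eqP cz|//].
    by move: zx; rewrite (inj z x) ?eqxx // cz.
  have : i \in c @: T by rewrite e inE iC orbT.
  case/imsetP => z zT iz; exists z => //; rewrite !inE zT andbT.
  by apply: contraNneq kC => zx; rewrite kx -zx -iz.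
have [cT|cT] := eqVneq (c @: T) C.
  rewrite (unique n) ?setD1K ?inE ?eqxx //.
  rewrite (_ : [set k | _] = set0) ?cards0 //.
  apply/setP => k; rewrite !inE cT; apply/negbTE/negP => /andP[kC /eqP e].
  by move: kC; rewrite e !inE eqxx.
have [cTn|cTn] := eqVneq (c @: T) (C :\ n).
  rewrite (card_redundant cTn) ?cTC //.
  rewrite (_ : [set k | _] = set0) ?cards0 //.
  apply/setP => k; rewrite !inE; apply/negbTE/negP => /andP[kC /eqP e].
  have : k \in C :\ n by rewrite -cTn e !inE eqxx.
  by rewrite inE (negbTE kC) andbF.
have [[k /andP[kC /eqP e]]|none] :=
    altP (@existsP I (fun k => (k \notin C) && (c @: T == k |: (C :\ n)))).
  have kCn : k \notin C :\ n by rewrite inE (negbTE kC) andbF.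
  rewrite (unique k e kCn) (_ : [set k | _] = [set k]) ?cards1 //.
  apply/setP => i; rewrite !inE; apply/andP/eqP => [[iC /eqP ei]|->]; last by rewrite e.
  have : i \in k |: (C :\ n) by rewrite -e ei !inE eqxx.
  by rewrite !inE (negbTE iC) andbF orbF => /eqP.
rewrite (_ : [set k | (k \notin C) && _] = set0) ?cards0 ?addn0; last first.
  apply/setP => k; rewrite !inE; move/existsPn: none => /(_ k).
  by move/negbTE.
rewrite (_ : [set _ in _ | _] = set0) ?cards0 //.
apply/setP => x; rewrite !inE; apply/negbTE/negP => /andP[xT /eqP e].
have e' := only _ xT e.
have [cx|cx] := boolP (c x \in C).
  have [cn|cn] := eqVneq (c x) n.
    by move: cT; rewrite e' cn setD1K // eqxx.
  by move: cTn; rewrite e' (setUidPr _) ?eqxx // sub1set !inE cn.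
by move/existsPn: none => /(_ (c x)); rewrite cx -e' eqxx.
Qed.

(** Both sides count the edges between deficient and balanced pairs. *)
Lemma double_counting :
  \sum_(p : {set X} * {set I} | deficient p.1 p.2)
    (#|[set x | (x \notin p.1) && dominant (x |: p.1) p.2]| +
     #|[set k in p.2 | dominant p.1 (p.2 :\ k)]|) =
  \sum_(p : {set X} * {set I} | balanced p.1 p.2)
    (#|[set x in p.1 | deficient (p.1 :\ x) p.2]| +
     #|[set k | (k \notin p.2) && deficient p.1 (k |: p.2)]|).
Proof.
have toS (J : finType) (P : pred J) : #|[set j | P j]| = \sum_j (P j : nat).
  by rewrite -sum1_card [RHS]big_mkcond /= big_mkcond; apply: eq_bigr => j _;
    rewrite inE.
rewrite !big_split /=; congr (_ + _).
- under eq_bigr do rewrite toS.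
  under [RHS]eq_bigr do rewrite toS.
  rewrite exchange_big [RHS]exchange_big /=; apply: eq_bigr => x _.
  rewrite -big_mkcondr -[RHS]big_mkcondr /=.
  rewrite [RHS](reindex_onto (fun p => (x |: p.1, p.2)) (fun p => (p.1 :\ x, p.2)))
    /=; last by move=> [T C] /= /andP[_ /andP[xT _]]; rewrite setD1K.
  apply: eq_bigl => -[T C] /=.
  have [xT|xT] := boolP (x \in T).
    rewrite andbF; apply/esym/negbTE/negP => /andP[_ /eqP[e]].
    by move: xT; rewrite -e !inE eqxx.
  rewrite setU1K // eqxx andbT !inE eqxx /= /balanced cardsU1 xT add1n.
  case l : (deficient T C); last by rewrite !andbF.
  by move: l => /and4P[_ _ /eqP -> _]; rewrite eqxx !andbT.
- under eq_bigr do rewrite toS.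
  under [RHS]eq_bigr do rewrite toS.
  rewrite exchange_big [RHS]exchange_big /=; apply: eq_bigr => k _.
  rewrite -big_mkcondr -[RHS]big_mkcondr /=.
  rewrite (reindex_onto (fun p => (p.1, k |: p.2)) (fun p => (p.1, p.2 :\ k))) /=;
    last by move=> [T C] /= /andP[_ /andP[kC _]]; rewrite setD1K.
  apply: eq_bigl => -[T C] /=.
  have [kC|kC] := boolP (k \in C).
    rewrite andbF; apply/negbTE/negP => /andP[_ /eqP[e]].
    by move: kC; rewrite -e !inE eqxx.
  rewrite setU1K // eqxx andbT !inE eqxx /= /balanced.
  case l : (deficient T (k |: C)); last by rewrite !andbF.
  move: l => /and4P[_ _]; rewrite cardsU1 kC add1n eqSS => /eqP -> _.
  by rewrite eqxx !andbT.
Qed.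

End Parity.

(** The pair with empty [T] and [C = {n}] is the only deficient pair of odd degree.
    So the number of edges is odd, and some balanced pair has odd degree. *)
Theorem dominant_coloring : exists T C,
  [/\ C != set0, dominant T C & c @: T = C].
Proof.
pose n := c x0.
have : odd (\sum_(p : {set X} * {set I} | deficient n p.1 p.2)
    (#|[set x | (x \notin p.1) && dominant (x |: p.1) p.2]| +
     #|[set k in p.2 | dominant p.1 (p.2 :\ k)]|)).
  have l0 : deficient n set0 [set n].
    rewrite /deficient inE eqxx cards1 cards0 eqxx imset0 setDv eqxx !andbT.
    apply/forallP => x; apply/exists_inP; exists n; rewrite ?inE //.
    by apply/forall_inP => t; rewrite inE.
  rewrite (bigD1 (set0, [set n])) //= oddD odd_degree_deficient ?eqxx ?cards0 ?cards1 //;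
    last by case/and4P: l0.
  suff -> : odd (\sum_(i | deficient n i.1 i.2 && (i != (set0, [set n])))
    (#|[set x | (x \notin i.1) && dominant (x |: i.1) i.2]| +
     #|[set k in i.2 | dominant i.1 (i.2 :\ k)]|)) = false by [].
  apply: (big_ind (fun m => odd m = false)) => // [x y ox oy|[T C]] /=.
    by rewrite oddD ox oy.
  case/andP => /and4P[d nC /eqP cC /eqP cT] ne; rewrite odd_degree_deficient //.
  apply: contraNF ne => /eqP T0; apply/eqP; congr pair => //.
  move/eqP: cC; rewrite T0 cards0 => /cards1P[m Cm].
  by move: nC; rewrite Cm inE => /eqP ->.
rewrite double_counting => o.
suff /existsP[[T C] /andP[/andP[d cTC] /eqP cT]] :
    [exists p : {set X} * {set I}, balanced p.1 p.2 && (c @: p.1 == p.2)].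
  exists T, C; split => //; apply: contraTneq d => -> /=.
  apply/forallPn; exists x0; apply/exists_inP => -[i]; by rewrite inE.
apply: contraLR o => /existsPn none.
apply: (big_ind (fun m => ~~ odd m)) => // [x y ox oy|p pn] /=.
  by rewrite oddD (negbTE ox).
by rewrite odd_degree_balanced //; have := none p; rewrite pn.
Qed.

End Dominance.

End DominantColorings.

Local Open Scope classical_set_scope.
Local Open Scope ring_scope.

(** * Brouwer's fixed point theorem on the simplex *)

Definition simplex (R : realType) n : set 'rV[R]_n :=
  [set p | (forall i, 0 <= p 0 i) /\ \sum_i p 0 i = 1].

Section Grid.
Variables (n K : nat).
Hypotheses (n0 : (0 < n)%N) (K0 : (0 < K)%N).

Definition grid := {x : {ffun 'I_n -> 'I_K.+1} | \sum_i (x i : nat) == K}.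

Definition coord (x : grid) i : nat := val x i.

(** The [i]-th coordinate, with ties broken by an enumeration of the grid so that
    each key is injective. *)
Definition grid_key i (x : grid) : nat := (coord x i * #|{: grid}| + enum_rank x)%N.

Lemma grid_key_inj i : injective (grid_key i).
Proof.
move=> x y e; apply: enum_rank_inj; apply: val_inj => /=.
have := congr1 (modn^~ #|{: grid}|) e.
by rewrite /grid_key !modnMDl !modn_small //; apply: ltn_ord.
Qed.

Lemma grid_key_le i x y : (grid_key i x <= grid_key i y -> coord x i <= coord y i)%N.
Proof.
move=> le; rewrite leqNgt; apply/negP => lt; move: le; apply/negP.
rewrite -ltnNge /grid_key.
apply: (@leq_trans ((coord y i).+1 * #|{: grid}|)).
  by rewrite mulSn addnC ltn_add2r; apply: ltn_ord.
by apply: leq_trans (leq_addr _ _); rewrite leq_mul2r lt orbT.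
Qed.

Lemma sum_coord x : (\sum_i coord x i = K)%N.
Proof. by apply/eqP; exact: (valP x). Qed.

Lemma grid_make (u : 'I_n -> nat) : (\sum_i u i = K)%N -> exists x, coord x =1 u.
Proof.
move=> uK.
have uB i : (u i < K.+1)%N by rewrite ltnS -uK (bigD1 i) //= leq_addr.
pose x : {ffun 'I_n -> 'I_K.+1} := [ffun i => Ordinal (uB i)].
have H : (\sum_i (x i : nat))%N == K.
  by rewrite -[in eqbRHS]uK; apply/eqP; apply: eq_bigr => i _; rewrite ffunE.
by exists (Sub x H : grid) => i; rewrite /coord SubK ffunE.
Qed.

Lemma grid_point : exists x : grid, True.
Proof.
have [|x _] := @grid_make (fun i => if i == Ordinal n0 then K else 0%N); last by exists x.
by rewrite -big_mkcond big_pred1_eq.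
Qed.

(** The sum over [C] of one plus the least [j]-th coordinate in [T] exceeds [K]:
    otherwise some grid point has all these coordinates larger than all of [T].
    As coordinates add up to [K], every point of [T] is close to the vector of these
    minima, extended by zero outside [C]. *)
Lemma grid_dominant (T : {set grid}) (C : {set 'I_n}) : C != finset.set0 ->
  dominant grid_key T C -> forall t t' i, t \in T -> t' \in T ->
    (coord t i <= coord t' i + n)%N /\ (i \notin C -> (coord t i <= n)%N).
Proof.
move=> C0 d t t' i tT t'T.
have T0 : T != finset.set0 by apply/set0Pn; exists t.
have [i0 i0C] := set0Pn _ C0.
pose m i := coord (low grid_key t T i) i.
have mle s j : s \in T -> (m j <= coord s j)%N.
  move=> sT; apply: grid_key_le; have [_ /forall_inP] := lowP grid_key t j T0; exact.
have big : (K < \sum_(j in C) (m j).+1)%N.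
  rewrite ltnNge; apply/negP => le.
  pose u j := (if j \in C then (m j).+1 + (if j == i0 then K - \sum_(j in C) (m j).+1 else 0)
               else 0)%N.
  have [|x xu] := @grid_make u.
    rewrite -big_mkcond /= big_split /= -big_mkcondr /=.
    rewrite [X in (_ + X)%N](eq_bigl (pred1 i0)); first by rewrite big_pred1_eq subnKC.
    by move=> j; rewrite /= andbC; case: eqP => // ->; rewrite i0C.
  have /exists_inP[j jC l] := forallP d x.
  have [lT _] := lowP grid_key t j T0.
  have /grid_key_le := forall_inP l _ lT.
  by rewrite xu /u jC -/(m j) addSn ltnNge leq_addr.
(* Hence the excess of a point of T over the minima is less than #|C|. *)
have {}big : (K < \sum_(j in C) m j + #|C|)%N.
  by move: big; under eq_bigr do rewrite -addn1; rewrite big_split /= sum1_card.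
have key s : s \in T ->
    (\sum_(j in C) (coord s j - m j) + \sum_(j | j \notin C) coord s j < #|C|)%N.
  move=> sT; have := sum_coord s; rewrite (bigID (mem C)) /= => e.
  move: big; rewrite -[X in (X < _)%N]e.
  have -> : (\sum_(j in C) coord s j =
             \sum_(j in C) (coord s j - m j) + \sum_(j in C) m j)%N.
    by rewrite -big_split /=; apply: eq_bigr => j _; rewrite subnK // mle.
  by rewrite addnAC addnC ltn_add2l.
have Cn : (#|C| <= n)%N by rewrite -[X in (_ <= X)%N]card_ord max_card.
have inC s j : s \in T -> j \in C -> (coord s j <= m j + n)%N.
  move=> sT jC; rewrite -leq_subLR; apply: leq_trans Cn.
  by apply: leq_trans (ltnW (key _ sT)); rewrite (bigD1 j) //= -addnA leq_addr.
have outC s j : s \in T -> j \notin C -> (coord s j <= n)%N.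
  move=> sT jC; apply: leq_trans Cn; apply: leq_trans (ltnW (key _ sT)).
  by rewrite [X in (_ <= _ + X)%N](bigD1 j) //= addnCA leq_addr.
split; last exact: outC.
have [iC|iC] := boolP (i \in C).
  by apply: leq_trans (inC _ _ tT iC) _; rewrite leq_add2r mle.
by apply: leq_trans (outC _ _ tT iC) _; rewrite leq_addl.
Qed.

Variables (R : realType) (h : 'rV[R]_n -> 'rV[R]_n).
Hypothesis hs : forall p, simplex p -> simplex (h p).

Definition gridpt (x : grid) : 'rV[R]_n := \row_i ((coord x i)%:R / K%:R).

Lemma gridpt_simplex x : simplex (gridpt x).
Proof.
split=> [i|]; first by rewrite mxE divr_ge0.
under eq_bigr do rewrite mxE.
by rewrite -mulr_suml -natr_sum sum_coord divff // pnatr_eq0 -lt0n.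
Qed.

(** Color a grid point with a coordinate that [h] does not decrease.  In a
    dominant pair using all colors of [C], each color of [C] occurs near any chosen
    point, and the remaining coordinates of this point almost vanish. *)
Lemma grid_fixed : exists2 p, simplex p & forall i,
  p 0 i <= n%:R / K%:R \/
  exists q, [/\ simplex q, forall j, `|p 0 j - q 0 j| <= n%:R / K%:R & q 0 i <= h q 0 i].
Proof.
have [x0 _] := grid_point.
have hc x : exists i, gridpt x 0 i <= h (gridpt x) 0 i.
  apply: contrapT => /forallNP H; have [_] := hs (gridpt_simplex x).
  have [_ <-] := gridpt_simplex x; apply/eqP; rewrite lt_eqF //.
  apply: ltr_sum => [|i _].
    by apply/hasP; exists (Ordinal n0); rewrite ?mem_index_enum.
  by rewrite ltNge; apply/negP; exact: H.
have [c cP] := choice hc.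
have [T [C [C0 d cT]]] := dominant_coloring c x0 grid_key_inj.
have Kp : 0 < K%:R :> R by rewrite ltr0n.
have [i0 i0C] := set0Pn _ C0.
move: (i0C); rewrite -cT => /imsetP[t tT _].
exists (gridpt t); first exact: gridpt_simplex.
move=> i; have [iC|iC] := boolP (i \in C); last first.
  left; rewrite mxE ler_pM2r ?invr_gt0 // ler_nat.
  by have [_ ->] := grid_dominant C0 d i tT tT.
right; move: iC; rewrite -cT => /imsetP[s sT ->].
exists (gridpt s); split=> [|j|]; [exact: gridpt_simplex| |exact: cP].
rewrite !mxE -mulrBl normrM (@ger0_norm _ K%:R^-1) ?invr_ge0 // ler_pM2r ?invr_gt0 //.
have [H1 _] := grid_dominant C0 d j tT sT.
have [H2 _] := grid_dominant C0 d j sT tT.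
have : (coord t j)%:R <= (coord s j)%:R + n%:R :> R by rewrite -natrD ler_nat.
have : (coord s j)%:R <= (coord t j)%:R + n%:R :> R by rewrite -natrD ler_nat.
by move=> l1 l2; rewrite ler_norml; apply/andP; split; lra.
Qed.

End Grid.

Lemma simplex_compact (R : realType) n : compact (@simplex R n).
Proof.
apply: bounded_closed_compact.
  exists 1; split => // x x1 p [p0 p1].
  apply/ltW; apply: le_lt_trans x1.
  rewrite /Num.norm /= mx_normrE; apply/bigmax_leP; split => //= -[i j] _ /=.
  by rewrite ord1 ger0_norm // -p1 (bigD1 j) //= lerDl sumr_ge0.
have cc i : continuous (fun p : 'rV[R]_n => p 0 i : R^o) by exact: coord_continuous.
have -> : @simplex R n = (\bigcap_(i in [set: 'I_n]) [set p | 0 <= p 0 i]) `&`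
    [set p | \sum_i p 0 i = 1].
  apply/seteqP; split => p.
    by move=> [p0 p1]; split => // i _; apply: p0.
  by move=> [p0 p1]; split => // i; apply: (p0 i).
apply: closedI.
  apply: closed_bigI => i _.
  apply: (@preimage_closed _ R^o (fun p : 'rV[R]_n => p 0 i) [set x | 0 <= x]).
    by move=> p _; apply: cc.
  exact: closed_ge.
apply: (@preimage_closed _ R^o (fun p : 'rV[R]_n => \sum_i p 0 i) [set x | x = 1]).
  have sc : continuous (fun p : 'rV[R]_n => \sum_i p 0 i : R^o).
    by apply: continuous_big => [|i _]; [exact: add_continuous | exact: cc].
  by move=> p _; apply: sc.
exact: closed_eq.
Qed.

(** At a cluster point of the points from [grid_fixed] no coordinate is
    decreased by [h], and the coordinates add up to 1 before and after. *)
Theorem brouwer_simplex (R : realType) n (h : 'rV[R]_n -> 'rV[R]_n) :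
  (0 < n)%N -> {within @simplex R n, continuous h} ->
  (forall p, simplex p -> simplex (h p)) -> exists2 p, simplex p & h p = p.
Proof.
move=> n0 hc hs.
have gf k : exists p, simplex p /\ forall i, p 0 i <= n%:R / k.+1%:R \/
  exists q, [/\ simplex q, forall j, `|p 0 j - q 0 j| <= n%:R / k.+1%:R & q 0 i <= h q 0 i].
  by have [p ps pP] := grid_fixed n0 (ltn0Sn k) hs; exists p.
have [u uP] := choice gf.
(* The approximate solutions of mesh 1 / (k + 1) cluster in the simplex. *)
have [p [ps pcl]] : @simplex R n `&` cluster (u @ \oo) !=set0.
  by apply: (@simplex_compact R n (u @ \oo)); exists 0%N => // k _; have [] := uP k.
exists p => //.
have le i : p 0 i <= h p 0 i.
  rewrite leNgt; apply/negP => lt.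
  pose eta := (p 0 i - h p 0 i) / 3%:R.
  have eta0 : 0 < eta by rewrite divr_gt0 // subr_gt0.
  have etaE : h p 0 i = p 0 i - 3%:R * eta by rewrite /eta; lra.
  have [hp0 _] := hs _ ps.
  have [e /= e0 eP] : exists2 e : R, 0 < e & forall q, simplex q -> ball p e q ->
      `|h p 0 i - h q 0 i| < eta.
    have [+ _] := @subspace_continuousP _ (@simplex R n) _ h.
    move=> /(_ hc p ps) /cvg_ballP /(_ eta eta0).
    move=> /nbhs_ballP[e /= e0 eP]; exists e => // q qs pq.
    by have [_ H] := eP _ pq qs; exact: H 0 i.
  pose d := Num.min (e / 2%:R) eta.
  have d0 : 0 < d by rewrite lt_min divr_gt0.
  have near_d : \forall k \near \oo, n%:R / k.+1%:R < d.
    have := @cvg_harmonic R; move=> /cvgrPdist_lt /(_ (d / n.+1%:R)) [].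
      by rewrite divr_gt0.
    move=> N _ NP; exists N => // k /NP /=; rewrite /harmonic /= sub0r normrN.
    rewrite ger0_norm // ltr_pdivlMr // mulrC => H.
    by apply: le_lt_trans H; rewrite ler_wpM2r // ler_nat.
  have [_ [[k [kd <-]] bk]] := pcl [set u k | k in [set k | n%:R / k.+1%:R < d]]
     (ball p d) (filterS (fun k (H : n%:R / k.+1%:R < d) => ex_intro2 _ _ k H erefl) near_d)
     (nbhsx_ballx p d d0).
  have {}kd : n%:R / k.+1%:R < d := kd.
  have {}bk j : `|p 0 j - u k 0 j| < d := bk.2 0 j.
  move: kd (uP k); set x := n%:R / k.+1%:R; move: x => x kd [us] /(_ i) [ui|[q [qs uq hq]]].
    have pu := bk i.
    have : p 0 i < 2%:R * eta.
      move: pu kd; rewrite /d !lt_min !ltr_norml => /andP[_ /andP[_ p1]] /andP[_ p2]; lra.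
    have := hp0 i; lra.
  have ne : 2%:R * x < e.
    by move: kd; rewrite lt_min => /andP[]; lra.
  have pq j : `|p 0 j - q 0 j| < e.
    have := bk j; rewrite /d lt_min => /andP[l1 _]; have l2 := uq j.
    rewrite (_ : p 0 j - q 0 j = (p 0 j - u k 0 j) + (u k 0 j - q 0 j)); last by lra.
    by apply: le_lt_trans (ler_normD _ _) _; lra.
  have {}eP : `|h p 0 i - h q 0 i| < eta.
    apply: eP => //.
    by split=> // a b; rewrite (ord1 a); apply: pq.
  move: eP; have := uq i; have := bk i; rewrite /d !lt_min !ltr_norml.
  move: kd; rewrite lt_min.
  move=> /andP[_ k2] /andP[_ /andP[l3 l4]]; rewrite ler_norml => /andP[l5 l6] /andP[l7 l8].
  lra.
have [p0 p1] := ps; have [h0 h1] := hs _ ps.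
apply/rowP => i; apply/eqP; rewrite eq_sym eq_le le /=.
rewrite leNgt; apply/negP => lt.
suff : \sum_i p 0 i < \sum_i h p 0 i by rewrite p1 h1 ltxx.
by rewrite (bigD1 i) //= [ltRHS](bigD1 i) //= ltr_leD // ler_sum.
Qed.

(** * Approximate fixed points of compact maps *)

Definition totally_bounded (R : realType) (E : normedModType R) (A : set E) :=
  forall e : R, 0 < e ->
    exists s : seq E, forall x, A x -> exists2 y, y \in s & `|x - y| < e.

Lemma precompact_totally_bounded (R : realType) (E : normedModType R) (A : set E) :
  precompact A -> totally_bounded A.
Proof.
rewrite precompactE compact_cover => cA e e0.
have [|x _|D _ cov] := cA E setT (fun y => ball y e).
- by move=> y _; exact: ball_open.
- by exists x => //; exact: ballxx.
exists (finmap.enum_fset D) => x Ax; have [y yD xy] := cov x (subset_closure Ax).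
by exists y => //; move: xy; rewrite -ball_normE /= distrC.
Qed.

(** Schauder projection: the weights of the points of a finite net, computed at
    [G] of a barycenter, define a self-map of the simplex.  At a fixed point the
    barycenter is an average of net points that are close to its image. *)
Theorem approximate_fixed_point (R : realType) (E : normedModType R) (G : E -> E) (e : R) :
  continuous G -> precompact (range G) -> 0 < e -> exists w, `|G w - w| <= e.
Proof.
move=> cG pG e0; have [s sP] := precompact_totally_bounded pG e0.
pose n := size s; pose y (i : 'I_n) := s`_i.
have cover w : exists i, `|G w - y i| < e.
  have [|z zs lt] := sP (G w); first by exists w.
  move: (zs); rewrite -index_mem => zi; exists (Ordinal zi).
  by rewrite /y /= nth_index.
have n0 : (0 < n)%N by have [i _] := cover 0; apply: leq_ltn_trans (ltn_ord i).
pose b (p : 'rV[R]_n) : E := \sum_i p 0 i *: y i.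
pose u i p : R^o := Num.max 0 (e - `|G (b p) - y i|).
pose U p : R^o := \sum_i u i p.
have u0 i p : 0 <= u i p by rewrite /u le_max lexx.
have U0 p : 0 < U p.
  have [i lt] := cover (b p); rewrite /U (bigD1 i) //= ltr_pwDl ?sumr_ge0 //.
  by rewrite /u lt_max subr_gt0 lt orbT.
have cb : continuous b.
  apply: continuous_big => [|i _]; first exact: add_continuous.
  have cc : continuous (fun p : 'rV[R]_n => p 0 i : R^o) by exact: coord_continuous.
  by move=> p; have := cvgZr_tmp (a := y i) (cc p); apply.
have cu i : continuous (u i).
  have cd : continuous (fun p => e - `|G (b p) - y i| : R^o).
    move=> p; have H : G (b q) @[q --> p] --> G (b p).
      by apply: continuous_comp; [exact: cb | exact: cG].
    exact: cvgB (cvg_cst _) (cvg_norm (cvgB H (cvg_cst _))).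
  by move=> p; exact: continuous_max (@cst_continuous _ R^o 0 p) (cd p).
have cU : continuous U.
  by apply: continuous_big => [|i _]; [exact: add_continuous | exact: cu].
pose h p : 'rV[R]_n := \row_i (u i p / U p).
have ch : continuous h.
  move=> p; apply: (iffRL (@cvg_ballP _ _ _ (nbhs p) (nbhs_filter p) h (h p))) => eps eps0.
  have cq i : continuous (fun q => u i q / U q : R^o).
    by move=> q; exact: cvgM (cu i q) (cvgV (lt0r_neq0 (U0 q)) (cU q)).
  have H i : \forall q \near p, ball (u i p / U p) eps (u i q / U q).
    by have /cvg_ballP := cq i p; apply.
  have := @filter_forall _ _ _ (nbhs p) (nbhs_filter p) H.
  by apply: filterS => q Hq; split => // a i; rewrite !mxE; apply: Hq.
have hs p : simplex (h p).
  split=> [i|]; first by rewrite mxE divr_ge0 // ltW.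
  under eq_bigr do rewrite mxE.
  by rewrite -mulr_suml (divff (lt0r_neq0 (U0 p))).
have [p [p0 p1] hp] := brouwer_simplex n0 (continuous_subspaceT ch) (fun p _ => hs p).
exists (b p).
have -> : G (b p) - b p = \sum_i p 0 i *: (G (b p) - y i).
  under [RHS]eq_bigr do rewrite scalerBr.
  by rewrite sumrB -scaler_suml p1 scale1r.
apply: le_trans (ler_norm_sum _ _ _) _; rewrite -[leRHS]mul1r -p1 mulr_suml.
apply: ler_sum => i _; rewrite normrZ ger0_norm //.
have [->|pi] := eqVneq (p 0 i) 0; first by rewrite !mul0r.
apply: ler_wpM2l => //; rewrite leNgt; apply/negP => lt.
move: pi; rewrite -hp mxE /u max_l ?mul0r ?eqxx //.
by rewrite subr_le0 ltW.
Qed.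

(** * Norming functionals *)

Section HahnBanach.
Variables (R : realType) (E : normedModType R).
Implicit Types (p q : E -> R) (x y v : E).

Definition sublinear p :=
  (forall x y, p (x + y) <= p x + p y) /\ (forall t x, 0 <= t -> p (t *: x) = t * p x).

Lemma sublinear0 p : sublinear p -> p 0 = 0.
Proof. by case=> _ h; rewrite -(scale0r 0) h // mul0r. Qed.

Lemma sublinearN p x : sublinear p -> - p (- x) <= p x.
Proof.
move=> sp; have [h _] := sp; have := h x (- x).
by rewrite subrr (sublinear0 sp) -lerBlDr sub0r.
Qed.

(** Directedness reduces the subadditivity of the infimum to that of a single
    member of the family.  This gives the lower bounds of chains in Zorn's lemma. *)
Lemma sublinear_inf (A : set (E -> R)) q :
  A !=set0 -> (forall f x, A f -> - q (- x) <= f x) -> (forall f, A f -> sublinear f) ->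
  (forall f g x y, A f -> A g -> exists2 h, A h & h x <= f x /\ h y <= g y) ->
  sublinear (fun x => inf [set f x | f in A]).
Proof.
move=> [f0 Af0] lb sA dir.
have hlb x : has_lbound [set f x | f in A].
  by exists (- q (- x)) => _ [f Af <-]; exact: lb.
have ne x : [set f x | f in A] !=set0 by exists (f0 x), f0.
split=> [x y|t x t0].
  rewrite -lerBlDr; apply: lb_le_inf => // _ [f Af <-].
  rewrite lerBlDr -lerBlDl; apply: lb_le_inf => // _ [g Ag <-]; rewrite lerBlDl.
  have [h Ah [hf hg]] := dir _ _ x y Af Ag.
  apply: (@le_trans _ _ (h (x + y))); first by apply: ge_inf => //; exists h.
  by have [sh _] := sA _ Ah; apply: le_trans (sh _ _) _; exact: lerD.
have [->|tn0] := eqVneq t 0.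
  rewrite scale0r mul0r (_ : [set f 0 | f in A] = [set 0]) ?inf1 //.
  apply/seteqP; split => [_ [f Af <-] /=|_ ->]; first by rewrite sublinear0 //; exact: sA.
  by exists f0 => //; rewrite sublinear0 //; exact: sA.
have tp : 0 < t by rewrite lt_neqAle eq_sym tn0.
apply/eqP; rewrite eq_le; apply/andP; split.
  rewrite mulrC -ler_pdivrMr //; apply: lb_le_inf => // _ [f Af <-].
  rewrite ler_pdivrMr // mulrC; have [_ <- //] := sA _ Af.
  by apply: ge_inf => //; exists f.
apply: lb_le_inf => // _ [f Af <-]; have [_ -> //] := sA _ Af.
by rewrite ler_pM2l //; apply: ge_inf => //; exists f.
Qed.

(** The functional is [x |-> inf_(t >= 0) (p (x + t v) - t p v)]. *)
Lemma sublinear_shift p v : sublinear p -> exists q,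
  [/\ sublinear q, forall x, q x <= p x & q (- v) <= - p v].
Proof.
move=> sp; have [pD pZ] := sp.
pose S x := [set p (x + t *: v) - t * p v | t in [set t : R | 0 <= t]].
have lb x t : 0 <= t -> - p (- x) <= p (x + t *: v) - t * p v.
  by move=> t0; have := pD (x + t *: v) (- x); rewrite addrAC subrr add0r pZ //; lra.
have hlb x : has_lbound (S x) by exists (- p (- x)) => _ [t t0 <-]; exact: lb.
have ne x : S x !=set0 by exists (p (x + 0 *: v) - 0 * p v), 0 => //=.
have leS x t : 0 <= t -> inf (S x) <= p (x + t *: v) - t * p v.
  by move=> t0; apply: ge_inf => //; exists t.
have le x : inf (S x) <= p x.
  by apply: le_trans (leS x 0 _) _ => //; rewrite scale0r addr0 mul0r subr0.
exists (fun x => inf (S x)); split => //; last first.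
  by apply: le_trans (leS _ 1 _) _ => //; rewrite scale1r mul1r addNr sublinear0 // add0r.
split=> [x y|s x s0].
  rewrite -lerBlDr; apply: lb_le_inf => // _ [t t0 <-].
  rewrite lerBlDr -lerBlDl; apply: lb_le_inf => // _ [u u0 <-]; rewrite lerBlDl.
  apply: le_trans (leS _ (t + u) _) _; first exact: addr_ge0.
  have := pD (x + t *: v) (y + u *: v).
  rewrite addrACA -scalerDl mulrDl; lra.
have [->|sn0] := eqVneq s 0.
  rewrite scale0r mul0r; apply/eqP; rewrite eq_le; apply/andP; split.
    by apply: le_trans (le _) _; rewrite sublinear0.
  by apply: lb_le_inf => // _ [t t0 <-]; rewrite add0r pZ // subrr.
have sp0 : 0 < s by rewrite lt_neqAle eq_sym sn0.
apply/eqP; rewrite eq_le; apply/andP; split.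
  rewrite mulrC -ler_pdivrMr //; apply: lb_le_inf => // _ [t t0 <-].
  rewrite ler_pdivrMr // [leRHS]mulrC mulrBr -(pZ s) // scalerDr scalerA mulrA.
  by apply: leS; exact: mulr_ge0.
apply: lb_le_inf => // _ [t t0 <-].
have -> : p (s *: x + t *: v) - t * p v = s * (p (x + (t / s) *: v) - (t / s) * p v).
  have st : s * (t / s) = t by rewrite mulrCA divff ?mulr1.
  by rewrite mulrBr -(pZ s) // scalerDr scalerA [s * (_ * p v)]mulrA st.
by rewrite ler_pM2l //; apply: leS; exact: divr_ge0.
Qed.

(** A sublinear functional that is minimal below another one is odd by
    [sublinear_shift], hence linear.  Starting the minimization from a functional
    that is already at most [- |v|] at [- v] forces the value [|v|] at [v]. *)
Theorem norming_functional v :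
  exists phi : E -> R^o, [/\ linear phi, forall x, `|phi x| <= `|x| & phi v = `|v|].
Proof.
have snorm : sublinear (fun x => `|x|).
  by split=> [x y|t x t0]; [exact: ler_normD | rewrite normrZ ger0_norm].
(* Minimizing below q, which is at most - |v| at - v. *)
have [q [sq qle qv]] := sublinear_shift v snorm.
pose T := {p : E -> R | sublinear p /\ forall x, p x <= q x}.
pose mk p (H : sublinear p /\ forall x, p x <= q x) : T := exist _ p H.
pose r (f g : T) := `[< forall x, sval g x <= sval f x >].
have [|||F tot|[p [sp pq]] pmax] := @Zorn T r.
- by move=> f; apply/asboolP.
- move=> f g h /asboolP fg /asboolP gh; apply/asboolP => x.
  exact: le_trans (gh x) (fg x).
- move=> [f sf] [g sg] /asboolP /= fg /asboolP /= gf; apply: eq_exist.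
  by apply/funext => x; apply/eqP; rewrite eq_le fg gf.
- have [[f0 Ff0]|F0] := pselect (exists f, F f); last first.
    by exists (mk q (conj sq (fun x => lexx _))) => f Ff; exfalso; apply: F0; exists f.
  pose A := [set sval f | f in F].
  have Aq f x : A f -> - q (- x) <= f x.
    move=> [[g [sg gq]] _ <-] /=; apply: le_trans (sublinearN x sg).
    by rewrite lerN2.
  have sA : sublinear (fun x => inf [set f x | f in A]).
    apply: (@sublinear_inf A q) => //; first by exists (sval f0), f0.
      by move=> _ [[g [sg gq]] _ <-].
    move=> _ _ x y [f Ff <-] [g Fg <-].
    have [/asboolP|/asboolP] := tot f g Ff Fg => H.
      by exists (sval g); [exists g | split].
    by exists (sval f); [exists f | split].
  have le f x : F f -> inf [set f x | f in A] <= sval f x.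
    move=> Ff; apply: ge_inf; last by exists (sval f) => //; exists f.
    by exists (- q (- x)) => _ [g Ag <-]; exact: Aq.
  have leq x : inf [set f x | f in A] <= q x.
    by apply: le_trans (le f0 x Ff0) _; case: (f0) => g /= [_]; apply.
  exists (mk _ (conj sA leq)) => f Ff; apply/asboolP => x /=; exact: le.
(* Minimality: the shift of p in any direction is p itself. *)
have pN x : p (- x) = - p x.
  have [g [sg gp gx]] := sublinear_shift x sp.
  have gq y : g y <= q y by apply: le_trans (gp y) (pq y).
  have := pmax (mk g (conj sg gq)).
  have -> : r (exist _ p (conj sp pq)) (mk g (conj sg gq)).
    by apply/asboolP.
  move=> /(_ isT) [gE]; apply/eqP; rewrite eq_le -{1}gE gx /=.
  by have := sublinearN (- x) sp; rewrite opprK.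
have [pD pZ] := sp.
have pDE x y : p (x + y) = p x + p y.
  apply/eqP; rewrite eq_le pD /=.
  by have := pD (x + y) (- y); rewrite addrK pN lerBrDr.
have ple x : p x <= `|x| by apply: le_trans (pq x) (qle x).
exists p; split.
- move=> t x y; rewrite pDE; congr (_ + _).
  have [t0|/ltW t0] := leP 0 t; first exact: pZ.
  by rewrite -[t]opprK scaleNr pN pZ ?oppr_ge0 // /GRing.scale /= !mulNr.
- by move=> x; rewrite ler_norml ple andbT lerNl -pN -(normrN x).
- apply/eqP; rewrite eq_le ple /= -[p v]opprK -pN lerNr.
  exact: le_trans (pq _) qv.
Qed.

Lemma functionalB (phi : E -> R^o) x y : linear phi -> phi (x - y) = phi x - phi y.
Proof. by move=> l; have := l (-1) y x; rewrite !scaleN1r [- y + x]addrC [- phi y + _]addrC. Qed.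

Lemma bounded_functional_dual (phi : E -> R^o) (C : R) :
  linear phi -> (forall x, `|phi x| <= C * `|x|) -> dual phi.
Proof.
move=> lphi bphi; split=> // x; apply/cvgrPdist_lt => e e0.
have C0 : 0 < Num.max C 1 by rewrite lt_max ltr01 orbT.
near=> y.
rewrite -functionalB //; apply: le_lt_trans (bphi _) _.
apply: (@le_lt_trans _ _ (Num.max C 1 * `|x - y|)).
  by rewrite ler_wpM2r // le_max lexx.
rewrite mulrC -ltr_pdivlMr //; near: y.
by apply: cvgr_dist_lt; rewrite ?divr_gt0.
Unshelve. all: by end_near. Qed.

Lemma dual_separates (x y : E) : (forall phi, dual phi -> phi x = phi y) -> x = y.
Proof.
move=> H; have [phi [lphi bphi phix]] := norming_functional (x - y).
have dphi : dual phi by apply: (@bounded_functional_dual _ 1) => // z; rewrite mul1r.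
apply/eqP; rewrite -subr_eq0 -normr_eq0 -phix.
by rewrite functionalB // H // subrr.
Qed.

End HahnBanach.

(** * Weak integrals of continuous functions *)

Section RealIntegral.
Variable R : realType.
Notation mu := (@lebesgue_measure R).
Implicit Types (g h : R -> R) (c d m k : R).

Definition rint c d g : R := \int[mu]_(x in `[c, d]) g x.
Definition integrable_on c d g := mu.-integrable `[c, d] (EFin \o g).

Lemma continuous_integrable_on c d (g : R -> R^o) : continuous g -> integrable_on c d g.
Proof.
move=> cg; apply: continuous_compact_integrable; first exact: segment_compact.
exact: continuous_subspaceT.
Qed.

Lemma integrable_onS c d c' d' g : c <= c' -> d' <= d ->
  integrable_on c d g -> integrable_on c' d' g.
Proof.
move=> cc dd; apply: integrableS => // x /=; rewrite !in_itv /= => /andP[c'x xd'].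
by rewrite (le_trans cc) //= (le_trans xd').
Qed.

Lemma integrable_onZ c d k g : integrable_on c d g -> integrable_on c d (fun x => k * g x).
Proof.
move=> ig; have mD : measurable (`[c, d]%classic : set (measurableTypeR R)) by [].
by have := integrableZl mD k ig; apply: eq_integrable => // x _; rewrite /= EFinM.
Qed.

Lemma rint_chasles c m d g : c <= m -> m <= d -> integrable_on c d g ->
  rint c d g = rint c m g + rint m d g.
Proof.
move=> cm md ig; have := @Rintegral_itvB R g (BLeft c) (BRight d) m ig.
rewrite !bnd_simp => /(_ cm md) H.
have mi : integrable_on m d g by apply: integrable_onS ig.
rewrite /rint -(@Rintegral_itv_obnd_cbnd _ m) -?H; first by rewrite addrC subrK.
by apply: integrableS mi => //; exact: subset_itv_oc_cc.
Qed.

Lemma rint_cst c d k : c <= d -> rint c d (fun=> k) = k * (d - c).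
Proof.
move=> cd; rewrite /rint Rintegral_cst //; congr (_ * _).
have /= -> := @lebesgue_measure_itv R `[c, d]; rewrite lte_fin.
by case: ltgtP cd => // -> _; rewrite subrr.
Qed.

Lemma rint_ge0 c d g : (forall x, c <= x <= d -> 0 <= g x) -> 0 <= rint c d g.
Proof. by move=> H; apply: Rintegral_ge0 => x /=; rewrite in_itv /=; exact: H. Qed.

Lemma rint_le c d g h : integrable_on c d g -> integrable_on c d h ->
  (forall x, c <= x <= d -> g x <= h x) -> rint c d g <= rint c d h.
Proof. by move=> ig ih H; apply: le_Rintegral => // x /=; rewrite in_itv /=; exact: H. Qed.

Lemma ae_imply (P Q : R -> Prop) : (forall x, P x -> Q x) ->
  {ae mu, forall x, P x} -> {ae mu, forall x, Q x}.
Proof. exact: (@filterS _ _ (ae_filter_ringOfSetsType mu)). Qed.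

Lemma ae_imply2 (P P' Q : R -> Prop) : (forall x, P x -> P' x -> Q x) ->
  {ae mu, forall x, P x} -> {ae mu, forall x, P' x} -> {ae mu, forall x, Q x}.
Proof.
move=> PQ HP HP'; have := @filterI _ _ (ae_filter_ringOfSetsType mu) _ _ HP HP'.
by apply: ae_imply => x []; exact: PQ.
Qed.

Lemma rint_le_ae c d g h : integrable_on c d g -> integrable_on c d h ->
  (forall x, 0 <= g x) -> (forall x, 0 <= h x) ->
  {ae mu, forall x, x \in `[c, d] -> g x <= h x} -> rint c d g <= rint c d h.
Proof.
move=> ig ih g0 h0 H; apply: fine_le.
- by apply: integrable_fin_num.
- by apply: integrable_fin_num.
- apply: ae_ge0_le_integral => //=.
  + by move=> x _; rewrite lee_fin.
  + by case/integrableP: ig.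
  + by move=> x _; rewrite lee_fin.
  + by case/integrableP: ih.
Qed.

End RealIntegral.

Section Vint.
Variables (R : realType) (E : normedModType R).
Hypothesis reflE : reflexive_space E.
Notation mu := (@lebesgue_measure R).
Implicit Types (u : R -> E) (c d m k : R).

Lemma functionalZ (phi : E -> R^o) k x : linear phi -> phi (k *: x) = k * phi x.
Proof.
move=> lphi; have p0 : phi 0 = 0 by have := functionalB 0 0 lphi; rewrite !subrr.
by have := lphi k x 0; rewrite !addr0 p0 addr0.
Qed.

Lemma opnorm_le (F : normedModType R) (T : E -> F) k x :
  (forall c y, T (c *: y) = c *: T y) -> (opnorm T <= k%:E)%E -> `|T x| <= k * `|x|.
Proof.
move=> TZ Tk; have [->|x0] := eqVneq x 0.
  by have := TZ 0 0; rewrite !scale0r => ->; rewrite !normr0 mulr0.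
have nx : 0 < `|x| by rewrite normr_gt0.
have : ((`|T (`|x|^-1 *: x)|)%:E <= opnorm T)%E.
  apply: ereal_sup_ubound; exists (`|x|^-1 *: x) => //=.
  by rewrite normrZ ger0_norm ?invr_ge0 // mulVf // gt_eqF.
move=> /le_trans /(_ Tk); rewrite lee_fin TZ normrZ ger0_norm ?invr_ge0 //.
by rewrite mulrC ler_pdivrMr.
Qed.

Lemma dual_opnorm (phi : E -> R^o) : dual phi ->
  exists k, [/\ 0 <= k, opnorm phi = k%:E & forall x, `|phi x| <= k * `|x|].
Proof.
move=> [lphi cphi].
have p0 : phi 0 = 0 by have := functionalB 0 0 lphi; rewrite !subrr.
have [e e0 eP] : exists2 e : R, 0 < e & forall x, `|x| < e -> `|phi x| < 1.
  have /cvgrPdist_lt /(_ 1 ltr01) /nbhs_ballP[e /= e0 eP] := cphi 0.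
  exists e => // x xe; have := eP x; rewrite -ball_normE /= sub0r normrN => /(_ xe).
  by rewrite p0 sub0r normrN.
have ub x : `|x| <= 1 -> `|phi x| <= 2%:R / e.
  move=> x1; have := eP ((e / 2%:R) *: x); rewrite normrZ gtr0_norm ?divr_gt0 //.
  rewrite functionalZ // normrM gtr0_norm ?divr_gt0 // => H.
  have /ltW : e / 2%:R * `|phi x| < 1.
    by apply: H; have := ler_wpM2l (ltW e0) x1; lra.
  by rewrite mulrC -ler_pdivlMr ?divr_gt0 // mul1r invf_div.
have ub' : (opnorm phi <= (2%:R / e)%:E)%E.
  by apply: ge_ereal_sup => _ [x /= x1 <-]; rewrite lee_fin ub.
have lb : (0 <= opnorm phi)%E.
  by apply: ereal_sup_ubound; exists 0; rewrite /= ?normr0 // p0 normr0.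
have fo : opnorm phi \is a fin_num.
  by rewrite ge0_fin_numE //; apply: le_lt_trans ub' _; rewrite ltry.
exists (fine (opnorm phi)); split; first exact: fine_ge0.
  by rewrite fineK.
move=> x; apply: opnorm_le; last by rewrite fineK.
by move=> a y; exact: functionalZ.
Qed.

Definition vint_spec c d u v :=
  forall phi : E -> R^o, dual phi -> phi v = rint c d (phi \o u).

(** The weak (Pettis) integral of [u] over [[c, d]]. *)
Definition vint c d u : E := xget 0 [set v | vint_spec c d u v].

Lemma continuous_phi (phi : E -> R^o) u : dual phi -> continuous u ->
  continuous (phi \o u : R -> R^o).
Proof. by move=> [_ cphi] cu x; apply: continuous_comp; [exact: cu|exact: cphi]. Qed.

Lemma continuous_nrm (V : normedModType R) (u : R -> V) :
  continuous u -> continuous (fun s => `|u s| : R^o).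
Proof. by move=> cu x; apply: cvg_norm; exact: cu. Qed.

(** The functional [phi |-> \int phi(u)] is bounded on the dual by [\int |u|], so
    reflexivity represents it by a vector. *)
Lemma vintP c d u : continuous u -> vint_spec c d u (vint c d u).
Proof.
move=> cu; suff [v vP] : exists v, vint_spec c d u v by apply: (xgetPex 0); exists v.
have ic phi : dual phi -> integrable_on c d (phi \o u).
  by move=> dphi; apply: continuous_integrable_on; exact: continuous_phi.
have [|v vP] := @reflE (fun phi => rint c d (phi \o u)).
  split=> [k phi psi dphi dpsi|].
    rewrite /rint RintegralD //;
      [|exact: (integrable_onZ k (ic _ dphi))|exact: ic].
    by rewrite RintegralZl //; exact: ic.
  exists (rint c d (fun s => `|u s|)) => phi dphi.
  have [k [k0 -> kP]] := dual_opnorm dphi; rewrite -EFinM lee_fin mulrC.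
  rewrite /rint; apply: le_trans (le_normr_Rintegral _ (ic _ dphi)) _ => //.
  have iu := @continuous_integrable_on R c d _ (continuous_nrm cu).
  rewrite -RintegralZl //; apply: rint_le => [||x _]; last exact: kP.
    by apply: continuous_integrable_on; apply: (@continuous_nrm R^o);
      exact: continuous_phi.
  exact: (integrable_onZ k iu).
by exists v => phi dphi; rewrite vP.
Qed.

Lemma vint_unique c d u v : continuous u -> vint_spec c d u v -> v = vint c d u.
Proof. by move=> cu vP; apply: dual_separates => phi dphi; rewrite vP // vintP. Qed.

Lemma vint_norm c d u : continuous u -> `|vint c d u| <= rint c d (fun s => `|u s|).
Proof.
move=> cu; have [phi [lphi phiB <-]] := norming_functional (vint c d u).
have dphi : dual phi by apply: (@bounded_functional_dual _ _ _ 1) => // z; rewrite mul1r.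
rewrite vintP //; apply: rint_le => [||x _].
- by apply: continuous_integrable_on; exact: continuous_phi.
- by apply: continuous_integrable_on; exact: continuous_nrm.
- by apply: le_trans (phiB _); exact: ler_norm.
Qed.

Lemma vintB c d u u' : continuous u -> continuous u' ->
  vint c d u - vint c d u' = vint c d (fun s => u s - u' s).
Proof.
move=> cu cu'; apply: vint_unique => [x|phi dphi]; first exact: cvgB (cu x) (cu' x).
have [lphi _] := dphi; rewrite functionalB // !vintP // /rint -RintegralB //.
- by apply: eq_Rintegral => x _ /=; rewrite functionalB.
- by apply: continuous_integrable_on; exact: continuous_phi.
- by apply: continuous_integrable_on; exact: continuous_phi.
Qed.

Lemma vint_chasles c m d u : c <= m -> m <= d -> continuous u ->
  vint c d u = vint c m u + vint m d u.
Proof.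
move=> cm md cu; apply: dual_separates => phi dphi; have [lphi _] := dphi.
have := lphi 1 (vint c m u) (vint m d u); rewrite !scale1r => ->.
rewrite !vintP //; apply: rint_chasles => //.
by apply: continuous_integrable_on; exact: continuous_phi.
Qed.

Lemma vint_cst c d (x : E) : c <= d -> vint c d (fun=> x) = (d - c) *: x.
Proof.
move=> cd; apply/esym; apply: vint_unique => [z|phi [lphi _]]; first exact: cvg_cst.
by rewrite functionalZ // /comp rint_cst // mulrC.
Qed.

Lemma vint_eq c d u u' : continuous u -> continuous u' ->
  (forall s, c <= s <= d -> u s = u' s) -> vint c d u = vint c d u'.
Proof.
move=> cu cu' uu; apply: vint_unique => // phi dphi; rewrite vintP //.
by apply: eq_Rintegral => s; rewrite inE /= in_itv /= => H; rewrite uu.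
Qed.

Lemma vint_linear c d u (T : {linear E -> E}) : continuous T -> continuous u ->
  T (vint c d u) = vint c d (T \o u).
Proof.
move=> cT cu; apply: vint_unique => [x|phi [lphi cphi]].
  by apply: continuous_comp; [exact: cu | exact: cT].
have dT : dual (phi \o T : E -> R^o).
  split=> [k x y|x]; first by rewrite /= linearP lphi.
  by apply: continuous_comp; [exact: cT | exact: cphi].
by have := @vintP c d u cu _ dT.
Qed.

Lemma vint_le c d u k : c <= d -> continuous u ->
  (forall s, c <= s <= d -> `|u s| <= k) -> `|vint c d u| <= k * (d - c).
Proof.
move=> cd cu H; apply: le_trans (vint_norm _ _ cu) _; rewrite -rint_cst //.
apply: rint_le => //.
- by apply: continuous_integrable_on; exact: continuous_nrm.
- by apply: continuous_integrable_on => z; exact: cvg_cst.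
Qed.

End Vint.

(** * Weak integrals of continuous functions are Bochner integrals *)

(** Heine's theorem.  Allowing [y] outside the interval saves side conditions at
    the end points. *)
Lemma uniform_modulus (R : realType) (E : normedModType R) (u : R -> E) (c d e : R) :
  continuous u -> 0 < e -> \forall n \near \oo, forall x, c <= x <= d ->
    forall y, `|x - y| <= n.+1%:R^-1 -> `|u x - u y| <= e.
Proof.
move=> cu e0; have := @segment_compact R c d; rewrite compact_near_coveringP.
move=> /(_ _ \oo (fun n x => forall y, `|x - y| <= n.+1%:R^-1 -> `|u x - u y| <= e) _).
case=> [x _|N _ NP]; last first.
  by exists N => // n /NP H x xcd; apply: H; rewrite /= in_itv.
have e2 : 0 < e / 2%:R by rewrite divr_gt0.
have /cvgrPdist_lt /(_ _ e2) /nbhs_ballP[eta /= eta0 H] := cu x.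
have eta2 : 0 < eta / 2%:R by rewrite divr_gt0.
exists (ball x (eta / 2%:R), [set n | n.+1%:R^-1 < eta / 2%:R]).
  split => /=; first exact: nbhsx_ballx.
  have /cvgrPdist_lt /(_ _ eta2) := @cvg_harmonic R.
  by apply: filterS => n; rewrite sub0r normrN /harmonic /= ger0_norm ?invr_ge0.
move=> [x' n] [/= xx' nn] y xy; rewrite -ball_normE /= in xx'.
have {}xy := le_lt_trans xy nn.
have H1 : `|u x - u x'| < e / 2%:R by apply: H; rewrite -ball_normE /=; lra.
have H2 : `|u x - u y| < e / 2%:R.
  apply: H; rewrite -ball_normE /=.
  have -> : x - y = (x - x') + (x' - y) by lra.
  by apply: le_lt_trans (ler_normD _ _) _; lra.
have -> : u x' - u y = (u x - u y) - (u x - u x') by rewrite opprB [RHS]addrC subrKA.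
by apply: le_trans (ler_normB _ _) _; lra.
Qed.

Section StepApproximation.
Variables (R : realType) (c d : R).
Hypothesis cd : c <= d.
Implicit Types (n i : nat) (x : R).

(** The mesh is [1 / (n + 1)] whatever the interval, so that degenerate intervals
    need no separate treatment; intersecting with [[c, d]] cuts the last cell. *)
Definition cells n := (Num.truncn ((d - c) * n.+1%:R)).+1.
Definition node n i : R := c + i%:R / n.+1%:R.
Definition cell n i : set R := `[c, d] `&` `[node n i, node n i.+1[.
Definition cell_of n x := Num.truncn ((x - c) * n.+1%:R).

Lemma cellP n i x : c <= x <= d -> (x \in cell n i) = (cell_of n x == i).
Proof.
move=> /andP[cx xd]; have n0 : 0 < n.+1%:R :> R by rewrite ltr0n.
have z0 : 0 <= (x - c) * n.+1%:R by rewrite mulr_ge0 // subr_ge0.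
have -> : (x \in cell n i) = (i%:R <= (x - c) * n.+1%:R < i.+1%:R).
  apply/idP/idP; rewrite inE /cell /node /= !in_itv /= cx xd.
    by case=> _; rewrite -lerBrDl -ltrBlDl ler_pdivrMr // ltr_pdivlMr.
  by rewrite -lerBrDl -ltrBlDl ler_pdivrMr // ltr_pdivlMr.
apply/idP/eqP => [|<-]; last exact: truncn_itv.
by move=> H; apply: truncn_def.
Qed.

Lemma cell_of_lt n x : c <= x <= d -> (cell_of n x < cells n)%N.
Proof.
move=> /andP[cx xd]; rewrite /cells ltnS; apply: le_truncn.
by rewrite ler_pM2r ?ltr0n // lerB.
Qed.

Lemma node_close n x : c <= x <= d -> `|x - node n (cell_of n x)| <= n.+1%:R^-1.
Proof.
move=> xcd; have : x \in cell n (cell_of n x) by rewrite cellP.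
rewrite inE => -[_]; rewrite /node /= in_itv /= => /andP[l1 l2].
rewrite ger0_norm ?subr_ge0 // lerBlDl; apply: (le_trans (ltW l2)).
by rewrite -addrA lerD2l -natr1 mulrDl mul1r.
Qed.

Lemma cell_sum (V : lmodType R) n (F : nat -> V) x : c <= x <= d ->
  \sum_(i < cells n) \1_(cell n i) x *: F i = F (cell_of n x).
Proof.
move=> xcd; rewrite (bigD1 (Ordinal (cell_of_lt n xcd))) //= big1 => [|i].
  by rewrite addr0 indicE cellP // eqxx scale1r.
move=> ine; rewrite indicE cellP // (_ : _ == _ = false) ?scale0r //.
by apply: contraNF ine => /eqP e; apply/eqP/val_inj.
Qed.

Lemma measurable_cell n i : measurable (cell n i : set (measurableTypeR R)).
Proof. exact: measurableI. Qed.

Lemma cell_finite n i : (lebesgue_measure (cell n i) < +oo)%E.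
Proof.
have H : (lebesgue_measure (cell n i) <= lebesgue_measure (`[c, d]%classic : set R))%E.
  apply: le_measure; rewrite ?inE; [exact: measurable_cell | by [] | by move=> x []].
apply: le_lt_trans H _; have /= -> := @lebesgue_measure_itv R `[c, d].
by case: ifP => _; rewrite ?ltry.
Qed.

Lemma integrable_cell n i k :
  integrable_on c d (fun x => \1_(cell n i) x * k).
Proof.
apply: measurable_bounded_integrable => //.
- have /= -> := @lebesgue_measure_itv R `[c, d].
  by case: ifP => _; rewrite ?ltry.
- apply: measurable_funM => //; first exact: measurable_indic (measurable_cell n i).
- exists `|k|; split => // z kz x _ /=; apply: ltW; apply: le_lt_trans kz.
  by rewrite normrM ger0_norm // -[leRHS]mul1r ler_wpM2r // indicE; case: (_ \in _).
Qed.

Lemma rint_cell n i k :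
  rint c d (fun x => \1_(cell n i) x * k) = fine (lebesgue_measure (cell n i)) * k.
Proof.
rewrite /rint RintegralZr //; last first.
  by have := integrable_cell n i 1; apply: eq_integrable => // x _; rewrite /= mulr1.
congr (fine _ * _); rewrite integral_indic //; last exact: measurable_cell.
by congr (lebesgue_measure _); apply/setIidPl => x [].
Qed.

Lemma rint_cells n (F : nat -> R) :
  integrable_on c d (fun x => F (cell_of n x)) /\
  rint c d (fun x => F (cell_of n x)) =
    \sum_(i < cells n) fine (lebesgue_measure (cell n i)) * F i.
Proof.
pose S (s : seq 'I_(cells n)) x := \sum_(i <- s) \1_(cell n i) x * F i.
have SP s : integrable_on c d (S s) /\
    rint c d (S s) = \sum_(i <- s) fine (lebesgue_measure (cell n i)) * F i.
  elim: s => [|i s [iS IH]].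
    rewrite big_nil (_ : S [::] = fun=> 0); last by apply/funext => x; rewrite /S big_nil.
    rewrite rint_cst // mul0r; split => //.
    by apply: continuous_integrable_on => z; exact: cvg_cst.
  have -> : S (i :: s) = fun x => \1_(cell n i) x * F i + S s x.
    by apply/funext => x; rewrite /S big_cons.
  have ii := integrable_cell n i (F i).
  split; last by rewrite /rint RintegralD // big_cons -IH; congr (_ + _); exact: rint_cell.
  have := integrableD (_ : measurable (`[c, d]%classic : set (measurableTypeR R))) ii iS.
  by apply => //.
have [iS eS] := SP (index_enum 'I_(cells n)).
have SE x : x \in `[c, d]%classic -> S (index_enum _) x = F (cell_of n x).
  rewrite inE /= in_itv /= => xcd; have := @cell_sum R^o n F x xcd.
  by rewrite /GRing.scale /=.
split; first by apply: eq_integrable iS => // x xcd; rewrite /= SE.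
by rewrite -eS; apply: eq_Rintegral => x xcd; rewrite SE.
Qed.

End StepApproximation.

Section BochnerOfContinuous.
Variables (R : realType) (E : normedModType R).
Hypothesis reflE : reflexive_space E.
Variables (c d : R) (u : R -> E).
Hypotheses (cd : c <= d) (cu : continuous u).

Definition step n : simple_data E :=
  @SimpleData R E (cells c d n) (fun i => cell c d n i) (fun i => u (node c n i)).

Lemma step_val n x : c <= x <= d -> simple_val (step n) x = u (node c n (cell_of c n x)).
Proof. by move=> xcd; rewrite /simple_val /= (cell_sum n (fun i => u (node c n i))). Qed.

Lemma step_close e : 0 < e -> \forall n \near \oo, forall x, c <= x <= d ->
  `|u x - simple_val (step n) x| <= e.
Proof.
move=> e0; have := @uniform_modulus R E u c d e cu e0; apply: filterS => n H x xcd.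
by rewrite step_val //; apply: H => //; exact: (node_close n xcd).
Qed.

(** The step functions of [step] converge uniformly on [[c, d]].  For the
    convergence of their integrals to the weak integral, a functional that norms the
    difference reduces the claim to a real integral. *)
Lemma vint_bochner (g : R -> E) : (forall s, c <= s <= d -> g s = u s) ->
  bochner_integral `[c, d] g (vint c d u).
Proof.
move=> gu; exists step; split.
- move=> n i; split; first exact: measurable_cell.
    by move=> x [].
  exact: cell_finite.
- apply: aeW => t /=; rewrite in_itv /= => tcd; rewrite gu //.
  apply/cvgrPdist_le => e e0; have := step_close e0.
  by apply: filterS => n; apply.
- apply/fine_cvgP.
  have fineE n : (\int[lebesgue_measure]_(t in `[c, d]) (`|g t - simple_val (step n) t|)%:E
     = (\int[lebesgue_measure]_(t in `[c, d])
        (\sum_(i < cells c d n) \1_(cell c d n i) t * `|u t - u (node c n i)|)%:E))%E.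
    apply: eq_integral => x; rewrite inE /= in_itv /= => xcd; rewrite gu // step_val //.
    by have := @cell_sum R c d R^o n (fun i => `|u x - u (node c n i)|) x xcd => /= ->.
  have mf n : measurable_fun `[c, d] (fun t : measurableTypeR R =>
      \sum_(i < cells c d n) \1_(cell c d n i) t * `|u t - u (node c n i)|).
    apply: measurable_sum => i; apply: measurable_funM.
      exact: measurable_indic (measurable_cell c d n i).
    apply: (measurable_funS measurableT) => //.
    apply: continuous_measurable_fun => x.
    by apply: cvg_norm; apply: cvgB; [exact: cu | exact: cvg_cst].
  have bound e : 0 < e -> \forall n \near \oo,
    (\int[lebesgue_measure]_(t in `[c, d]) (`|g t - simple_val (step n) t|)%:E
      <= (e * (d - c))%:E)%E.
    move=> e0; have := step_close e0; apply: filterS => n H; rewrite fineE.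
    have -> : ((e * (d - c))%:E = \int[lebesgue_measure]_(t in `[c, d]) cst e%:E t)%E.
      rewrite integral_cst //=; have /= -> := @lebesgue_measure_itv R `[c, d].
      by rewrite lte_fin; case: ltgtP cd => // -> _; rewrite subrr mulr0 mule0.
    apply: ge0_le_integral => //=.
    + by move=> x _; rewrite lee_fin sumr_ge0 // => i _; rewrite mulr_ge0.
    + by apply/measurable_EFinP; exact: mf.
    + move=> x; rewrite in_itv /= => xcd; rewrite lee_fin.
      have := @cell_sum R c d R^o n (fun i => `|u x - u (node c n i)|) x xcd => /= ->.
      by rewrite -step_val // H.
  have ge0 n : (0 <= \int[lebesgue_measure]_(t in `[c, d])
      (`|g t - simple_val (step n) t|)%:E)%E.
    by apply: integral_ge0 => x _; rewrite lee_fin.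
  split.
    have := bound 1 ltr01; apply: filterS => n H.
    by rewrite ge0_fin_numE //; apply: le_lt_trans H _; rewrite ltry.
  apply/cvgrPdist_le => e e0.
  have e1 : 0 < e / (d - c + 1) by rewrite divr_gt0 // ltr_wpDl // subr_ge0.
  have := bound _ e1; apply: filterS => n H /=.
  rewrite sub0r normrN ger0_norm ?fine_ge0 //.
  have fin : (\int[lebesgue_measure]_(t in `[c, d])
      (`|g t - simple_val (step n) t|)%:E \is a fin_num)%E.
    by rewrite ge0_fin_numE //; apply: le_lt_trans H _; rewrite ltry.
  rewrite -lee_fin fineK //; apply: le_trans H _; rewrite lee_fin.
  rewrite mulrAC ler_pdivrMr; last by rewrite ltr_wpDl // subr_ge0.
  by rewrite ler_pM2l // lerDl.
- apply/cvgrPdist_le => e e0.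
  have e1 : 0 < e / (d - c + 1) by rewrite divr_gt0 // ltr_wpDl // subr_ge0.
  have := step_close e1; apply: filterS => n H.
  set w := _ - _; have [phi [lphi phiB <-]] := norming_functional w.
  have dphi : dual phi by apply: (@bounded_functional_dual _ _ _ 1) => // z; rewrite mul1r.
  rewrite /w functionalB // vintP //.
  have -> : phi (simple_int (step n)) =
      rint c d (fun x => phi (u (node c n (cell_of c n x)))).
    rewrite (rint_cells cd n (fun i => phi (u (node c n i)))).2 /simple_int.
    have p0 : phi 0 = 0 by have := functionalB 0 0 lphi; rewrite !subrr.
    have phiD x y : phi (x + y) = phi x + phi y.
      by have := lphi 1 x y; rewrite !scale1r.
    rewrite (big_morph phi phiD p0); apply: eq_bigr => i _; exact: functionalZ.
  have ipu : integrable_on c d (phi \o u).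
    by apply: continuous_integrable_on; exact: continuous_phi.
  have [ist _] := rint_cells cd n (fun i => phi (u (node c n i))).
  rewrite /rint -RintegralB //.
  apply: (@le_trans _ _ (rint c d (fun=> e / (d - c + 1)))).
    apply: rint_le => [||x xcd] /=.
    - have mD : measurable (`[c, d]%classic : set (measurableTypeR R)) by [].
      by have := integrableB mD ipu ist; apply: eq_integrable.
    - by apply: continuous_integrable_on => z; exact: cvg_cst.
    - rewrite -functionalB // -step_val //; apply: le_trans (H x xcd).
      by apply: le_trans (phiB _); exact: ler_norm.
  rewrite rint_cst // mulrAC ler_pdivrMr; last by rewrite ltr_wpDl // subr_ge0.
  by rewrite ler_pM2l // lerDl.
Qed.

End BochnerOfContinuous.

(** * Contraction semigroups *)

Section Semigroup.
Variables (R : realType) (E : completeNormedModType R).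
Variable S : R -> {linear E -> E}.
Hypotheses (C0S : C0_semigroup S) (contrS : contraction_semigroup S).

Lemma semigroup_contr t x : 0 <= t -> `|S t x| <= `|x|.
Proof.
move=> t0; rewrite -[leRHS]mul1r; apply: opnorm_le; last exact: contrS.
by move=> c y; rewrite linearZ.
Qed.

Lemma semigroup0 x : S 0 x = x.
Proof. by case: C0S. Qed.

Lemma semigroupD s t x : 0 <= s -> 0 <= t -> S (s + t) x = S s (S t x).
Proof. by move=> s0 t0; case: C0S => _ _ + _; apply. Qed.

Lemma semigroup_near0 x e : 0 < e -> exists2 d : R, 0 < d &
  forall h, 0 <= h < d -> `|S h x - x| < e.
Proof.
move=> e0; have [_ _ _ /(_ x)] := C0S => /cvgrPdist_lt /(_ e e0).
move=> /nbhs_ballP[d /= d0 dP]; exists d => // h /andP[h0 hd].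
have [->|hn0] := eqVneq h 0; first by rewrite semigroup0 subrr normr0.
rewrite distrC; apply: dP; last by rewrite lt_neqAle eq_sym hn0.
by rewrite /ball /= sub0r normrN ger0_norm.
Qed.

(** Factor out the semigroup at the smaller of the two times, a contraction. *)
Lemma semigroup_dist s t x : 0 <= s -> 0 <= t ->
  `|S s x - S t x| <= `|S `|s - t| x - x|.
Proof.
wlog st : s t / s <= t.
  move=> H s0 t0; have [st|/ltW ts] := leP s t; first exact: H.
  by rewrite distrC [`|s - t|]distrC; apply: H.
move=> s0 t0; rewrite distrC [`|s - t|]distrC ger0_norm ?subr_ge0 //.
rewrite -{1}(subrKC s t) semigroupD ?subr_ge0 // -linearB.
exact: semigroup_contr.
Qed.

(** Extending by the identity at negative times makes [s |-> S (t - s) (g s)]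
    continuous on the whole line. *)
Definition flow (t : R) (x : E) : E := S (Num.max 0 t) x.

Lemma flowE t x : 0 <= t -> flow t x = S t x.
Proof. by move=> t0; rewrite /flow max_r. Qed.

Lemma flow_contr t x : `|flow t x| <= `|x|.
Proof. by apply: semigroup_contr; rewrite le_max lexx. Qed.

Lemma flowB t x y : flow t (x - y) = flow t x - flow t y.
Proof. by rewrite /flow linearB. Qed.

Lemma flow_continuous : continuous (fun p : R * E => flow p.1 p.2).
Proof.
move=> [t x]; apply/cvgrPdist_lt => e e0 /=.
have e2 : 0 < e / 2%:R by rewrite divr_gt0.
have [d d0 dP] := semigroup_near0 x e2.
exists (ball t d, ball x (e / 2%:R)); first by split; exact: nbhsx_ballx.
move=> [s y] [/= ts xy]; rewrite -ball_normE /= in xy; rewrite /ball /= in ts.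
have -> : flow t x - flow s y = (flow t x - flow s x) + flow s (x - y).
  by rewrite flowB subrKA.
have H1 : `|flow s (x - y)| < e / 2%:R by apply: le_lt_trans (flow_contr _ _) _.
have H2 : `|flow t x - flow s x| < e / 2%:R.
  rewrite /flow; apply: le_lt_trans (semigroup_dist _ _ _) _;
    rewrite ?le_max ?lexx //.
  apply: dP; rewrite normr_ge0 /=; apply: le_lt_trans ts.
  by rewrite /Num.max; case: ltP => ?; case: ltP => ?;
    rewrite ler_norml; apply/andP; split; have := ler_norm (t - s);
    have := ler_norm (s - t); rewrite [`|s - t|]distrC; have := normr_ge0 (t - s); lra.
by apply: le_lt_trans (ler_normD _ _) _; lra.
Qed.

Lemma continuous_flow (T : topologicalType) (h : T -> R) (g : T -> E) :
  continuous h -> continuous g -> continuous (fun s => flow (h s) (g s)).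
Proof.
move=> ch cg s.
apply: (@continuous_comp _ _ _ (fun s => (h s, g s)) (fun p => flow p.1 p.2)).
  exact: (cvg_pair (ch s) (cg s)).
exact: flow_continuous.
Qed.

(** Strong continuity is uniform on totally bounded sets, as it is uniform on
    finite nets and the semigroup is equicontinuous. *)
Lemma semigroup_near0_totally_bounded (A : set E) e : totally_bounded A -> 0 < e ->
  exists2 d : R, 0 < d & forall h x, 0 <= h < d -> A x -> `|S h x - x| <= e.
Proof.
move=> tA e0; have e3 : 0 < e / 3%:R by rewrite divr_gt0.
have [s sP] := tA _ e3.
have [d d0 dP] : exists2 d : R, 0 < d & forall h y, 0 <= h < d -> y \in s ->
    `|S h y - y| < e / 3%:R.
  elim: s {sP} => [|y s [d d0 dP]]; first by exists 1.
  have [d' d'0 d'P] := semigroup_near0 y e3.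
  exists (Num.min d d'); first by rewrite lt_min d0.
  move=> h z; rewrite lt_min inE => /and3P[h0 hd hd'] /orP[/eqP ->|zs].
    by apply: d'P; rewrite h0.
  by apply: dP => //; rewrite h0.
exists d => // h x hd Ax; have [y ys xy] := sP x Ax.
have -> : S h x - x = S h (x - y) + (S h y - y) - (x - y).
  by rewrite linearB addrA subrK opprB addrA subrK.
have h0 : 0 <= h by case/andP: hd.
apply: le_trans (ler_normB _ _) _; have := ler_normD (S h (x - y)) (S h y - y).
have := semigroup_contr (x - y) h0; have := dP h y hd ys; lra.
Qed.

End Semigroup.

(** * Duhamel integrals *)

Section Duhamel.
Variables (R : realType) (E : completeNormedModType R).
Hypothesis reflE : reflexive_space E.
Variable S : R -> {linear E -> E}.
Hypotheses (C0S : C0_semigroup S) (contrS : contraction_semigroup S).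
Implicit Types (g h : R -> E).

(** The integral term of the variation of constants formula, started at time
    [c]. *)
Definition duhamel g (c t : R) : E := vint c t (fun s => flow S (t - s) (g s)).

Lemma duhamel_integrand_continuous g t : continuous g ->
  continuous (fun s => flow S (t - s) (g s)).
Proof.
move=> cg; apply: continuous_flow => // s.
by apply: cvgB; [exact: cvg_cst | exact: cvg_id].
Qed.

Lemma duhamel_norm g c t : continuous g ->
  `|duhamel g c t| <= rint c t (fun s => `|g s|).
Proof.
move=> cg; apply: le_trans (vint_norm reflE _ _ _) _; first exact: duhamel_integrand_continuous.
apply: rint_le => [||s _]; last exact: flow_contr.
  by apply: continuous_integrable_on; apply: (@continuous_nrm R E);
    exact: duhamel_integrand_continuous.
by apply: continuous_integrable_on; exact: continuous_nrm.
Qed.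

Lemma duhamelB g h c t : continuous g -> continuous h ->
  duhamel g c t - duhamel h c t = duhamel (fun s => g s - h s) c t.
Proof.
move=> cg ch; rewrite /duhamel vintB //; try exact: duhamel_integrand_continuous.
by congr vint; apply/funext => s; rewrite flowB.
Qed.

(** Evolving first to time [m]: the semigroup law under the integral sign. *)
Lemma duhamel_split g c m t : c <= m -> m <= t -> continuous g ->
  duhamel g c t = S (t - m) (duhamel g c m) + duhamel g m t.
Proof.
move=> cm mt cg; rewrite /duhamel (vint_chasles reflE cm mt); last first.
  exact: duhamel_integrand_continuous.
congr (_ + _); rewrite vint_linear //; last first.
- exact: duhamel_integrand_continuous.
- by case: C0S => + _ _ _; apply; rewrite subr_ge0.
have cS : continuous (S (t - m)) by case: C0S => + _ _ _; apply; rewrite subr_ge0.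
apply: vint_eq => //; first exact: duhamel_integrand_continuous.
  move=> s; apply: continuous_comp; last exact: cS.
  exact: duhamel_integrand_continuous.
move=> s /andP[_ sm] /=; have st := le_trans sm mt.
rewrite !flowE ?subr_ge0 // -(semigroupD C0S) ?subr_ge0 //.
by congr (S _ _); rewrite addrA subrK.
Qed.

Lemma duhamel_eq g h c t : continuous g -> continuous h ->
  (forall s, c <= s <= t -> g s = h s) -> duhamel g c t = duhamel h c t.
Proof.
move=> cg ch gh; apply: vint_eq => //; try exact: duhamel_integrand_continuous.
by move=> s sct; rewrite gh.
Qed.

Lemma duhamel_refl g c : continuous g -> duhamel g c c = 0.
Proof.
move=> cg; apply/eqP; rewrite -normr_le0.
have ig : integrable_on c c (fun s => `|g s|).
  by apply: continuous_integrable_on; exact: continuous_nrm.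
by have := duhamel_norm c c cg; have := rint_chasles (lexx c) (lexx c) ig; lra.
Qed.

Section Dominated.
Variables (a b : R) (nu : R -> R).
Hypotheses (ab : a <= b) (nu0 : forall s, 0 <= nu s) (inu : integrable_on a b nu).

(** Sources are not bounded uniformly, only by one integrable function; this is
    what makes the integral terms below equicontinuous. *)
Definition dominated g :=
  {ae @lebesgue_measure R, forall s, s \in `[a, b] -> `|g s| <= nu s}.

Lemma dominated_duhamel g c t : continuous g -> dominated g -> a <= c -> t <= b ->
  `|duhamel g c t| <= rint c t nu.
Proof.
move=> cg dg ac tb; apply: le_trans (duhamel_norm _ _ cg) _.
apply: rint_le_ae => //.
- by apply: continuous_integrable_on; exact: continuous_nrm.
- exact: integrable_onS inu.
- apply: (ae_imply _ dg) => s H; rewrite in_itv /= => /andP[cs st]; apply: H.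
  by rewrite in_itv /= (le_trans ac) //= (le_trans st).
Qed.

Lemma rint_nu_le c t : a <= c -> c <= t -> t <= b -> rint c t nu <= rint a b nu.
Proof.
move=> ac ct tb.
rewrite (rint_chasles ac (le_trans ct tb) inu).
rewrite (@rint_chasles _ c t b) //; last exact: integrable_onS inu.
have := @rint_ge0 R a c nu (fun s _ => nu0 s).
have := @rint_ge0 R t b nu (fun s _ => nu0 s); lra.
Qed.

(** Absolute continuity of the integral of [nu], locally at [t0]. *)
Lemma rint_nu_small t0 e : a <= t0 <= b -> 0 < e -> exists2 d : R, 0 < d &
  forall c t, a <= c -> c <= t -> t <= b -> t0 - d < c -> t < t0 + d -> rint c t nu < e.
Proof.
move=> t0ab e0; have e2 : 0 < e / 2%:R by rewrite divr_gt0.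
have := parameterized_integral_continuous ab inu.
move=> /subspace_continuousP /(_ t0); rewrite /= in_itv /= => /(_ t0ab).
move=> /cvgrPdist_lt /(_ _ e2) /nbhs_ballP[d /= d0 dP]; exists d => // c t ac ct tb dc td.
have near x : a <= x <= b -> `|t0 - x| < d -> `|rint a t0 nu - rint a x nu| < e / 2%:R.
  by move=> xab xd; apply: dP => //=; rewrite in_itv.
have [/andP[at0 t0b]] := (t0ab, I).
have H1 := near c; have H2 := near t.
have : rint a t nu = rint a c nu + rint c t nu.
  by apply: rint_chasles => //; exact: integrable_onS inu.
move: H1 H2; rewrite ac (le_trans ct tb) (le_trans ac ct) tb.
move=> /(_ isT) H1 /(_ isT) H2.
have [tt|tt] := leP t0 c.
  have /H1 : `|t0 - c| < d by rewrite ler0_norm ?subr_le0 //; lra.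
  have /H2 : `|t0 - t| < d by rewrite ler0_norm ?subr_le0 ?(le_trans tt) //; lra.
  by rewrite !ltr_norml => /andP[? ?] /andP[? ?]; lra.
have /H1 : `|t0 - c| < d by rewrite gtr0_norm ?subr_gt0 //; lra.
have [tt'|tt'] := leP t0 t.
  have /H2 : `|t0 - t| < d by rewrite ler0_norm ?subr_le0 //; lra.
  by rewrite !ltr_norml => /andP[? ?] /andP[? ?]; lra.
have /H2 : `|t0 - t| < d by rewrite gtr0_norm ?subr_gt0 //; lra.
by rewrite !ltr_norml => /andP[? ?] /andP[? ?]; lra.
Qed.

(** Dominated convergence, applied to the norm of the difference of the
    sources. *)
Lemma duhamel_cvg (g_ : nat -> R -> E) g t : a <= t <= b ->
  (forall n, continuous (g_ n)) -> continuous g ->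
  (forall n, dominated (g_ n)) -> dominated g ->
  (forall s, a < s <= b -> g_ n s @[n --> \oo] --> g s) ->
  duhamel (g_ n) a t @[n --> \oo] --> duhamel g a t.
Proof.
move=> /andP[ta tb] cg_ cg dg_ dg gcvg.
pose k n s : R := `|g_ n s - g s|.
have ck n : continuous (k n : R -> R^o).
  by apply: continuous_nrm => s; exact: cvgB (cg_ n s) (cg s).
have inu' := integrable_onS (lexx a) tb inu.
have i2 : integrable_on a t (fun s => 2%:R * nu s) by exact: integrable_onZ.
have mD : measurable (`[a, t]%classic : set (measurableTypeR R)) by [].
have mk n : measurable_fun (`[a, t]%classic : set (measurableTypeR R)) (EFin \o k n).
  apply/measurable_EFinP; apply: (measurable_funS measurableT) => //.
  exact: continuous_measurable_fun.
have m0 : measurable_fun (`[a, t]%classic : set (measurableTypeR R)) (fun=> 0%E : \bar R).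
  exact: measurable_cst.
have kcvg : {ae @lebesgue_measure R, forall s, `[a, t]%classic s ->
    (EFin \o k n) s @[n --> \oo] --> 0%E}.
  have : lebesgue_measure.-negligible [set a].
    by apply/negligibleP; [exact: measurable_set1 | exact: lebesgue_measure_set1].
  apply: negligibleS => s /= H; apply/eqP; apply: contrapT => sa; apply: H.
  rewrite in_itv /= => /andP[as_ st].
  apply/fine_cvgP; split; first by apply: nearW.
  have H : g_ n s @[n --> \oo] --> g s.
    apply: gcvg; rewrite (le_trans st tb) andbT lt_neqAle as_ andbT.
    by apply/eqP => e; apply: sa; rewrite e.
  have := cvg_norm (cvgB H (cvg_cst (g s))).
  rewrite subrr normr0; exact.
have kdom : {ae @lebesgue_measure R, forall s n, `[a, t]%classic s ->
    (`|(EFin \o k n) s| <= (2%:R * nu s)%:E)%E}.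
  have dn : {ae @lebesgue_measure R, forall s, forall n, s \in `[a, b] -> `|g_ n s| <= nu s}.
    by apply: ae_foralln.
  apply: (ae_imply2 _ dn dg) => s H1 H2 n /=; rewrite in_itv /= => /andP[as_ st].
  have sab : s \in `[a, b] by rewrite in_itv /= as_ (le_trans st).
  rewrite lee_fin /k normr_id; apply: le_trans (ler_normB _ _) _.
  have := H1 n sab; have := H2 sab; lra.
have [_ _ K] := dominated_convergence mD mk m0 kcvg i2 kdom.
have {}K : rint a t (k n) @[n --> \oo] --> (0 : R).
  move: K; rewrite integral0 => /fine_cvgP[_].
  exact.
apply/cvgrPdist_lt => e e0; have /cvgrPdist_lt /(_ e e0) := K.
apply: filterS => n; rewrite sub0r normrN ger0_norm;
  last by apply: rint_ge0 => x _; exact: normr_ge0.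
move=> H; rewrite distrC duhamelB //; apply: le_lt_trans H.
apply: duhamel_norm => s; exact: cvgB (cg_ n s) (cg s).
Qed.

Hypothesis cptS : compact_semigroup S.

Lemma semigroup_image_totally_bounded t C : 0 < t ->
  totally_bounded [set S t x | x in [set x : E | `|x| <= C]].
Proof.
move=> t0; apply/precompact_totally_bounded/cptS => //.
exists C; split; first exact: num_real.
by move=> z Cz x /= xC; apply: le_trans xC (ltW Cz).
Qed.

(** Up to the small contribution of the last time span [h], the integral is the
    image under the compact operator [S h] of a bounded set. *)
Lemma duhamel_totally_bounded t : a <= t <= b ->
  totally_bounded [set duhamel g a t | g in [set g | continuous g /\ dominated g]].
Proof.
move=> tab e e0; have [/andP[ta tb]] := (tab, I).
have e2 : 0 < e / 2%:R by rewrite divr_gt0.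
have [d d0 dP] := rint_nu_small tab e2.
move: ta; rewrite le_eqVlt => /orP[/eqP ta|ta].
  exists [:: 0] => _ [g [cg dg] <-]; exists 0; rewrite ?inE //.
  by rewrite -ta duhamel_refl // subr0 normr0.
pose h := Num.min (d / 2%:R) (t - a).
have h0 : 0 < h by rewrite lt_min divr_gt0 // subr_gt0.
have ha : a <= t - h by have : h <= t - a by [rewrite ge_min lexx orbT]; lra.
have hd : h < d.
  have : h <= d / 2%:R by rewrite ge_min lexx.
  by lra.
have [s sP] := semigroup_image_totally_bounded (rint a b nu) h0 e2.
exists s => _ [g [cg dg] <-].
have th : t - h <= t by lra.
have [|y ys H] := sP (S h (duhamel g a (t - h))).
  exists (duhamel g a (t - h)) => //=.
  apply: le_trans (dominated_duhamel cg dg (lexx a) _) _; first by lra.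
  by apply: rint_nu_le => //; lra.
exists y => //; rewrite (duhamel_split ha th cg) (_ : t - (t - h) = h); last by lra.
rewrite addrAC; apply: le_lt_trans (ler_normD _ _) _.
have := dominated_duhamel cg dg ha tb.
have : rint (t - h) t nu < e / 2%:R by apply: dP => //; lra.
lra.
Qed.

(** Near [t0 > a] the integrals are, up to small terms, of the form [S k z] with
    [z] in the totally bounded image of a ball under [S (h / 2)], on which the
    semigroup is equicontinuous by [semigroup_near0_totally_bounded]. *)
Lemma duhamel_equicontinuous t0 e : a <= t0 <= b -> 0 < e -> exists2 d : R, 0 < d &
  forall g t, continuous g -> dominated g -> a <= t <= b -> `|t - t0| < d ->
    `|duhamel g a t - duhamel g a t0| <= e.
Proof.
move=> tab e0; have [/andP[ta tb]] := (tab, I).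
have e4 : 0 < e / 4%:R by rewrite divr_gt0.
have [d d0 dP] := rint_nu_small tab e4.
move: ta; rewrite le_eqVlt => /orP[/eqP ta|ta].
  exists d => // g t cg dg /andP[at_ tb'] tt; rewrite -ta duhamel_refl // subr0.
  apply: le_trans (dominated_duhamel cg dg (lexx a) tb') _.
  have : rint a t nu < e / 4%:R.
    by apply: dP => //; move: tt; rewrite ltr_norml => /andP[]; lra.
  by lra.
pose h := Num.min (d / 2%:R) (t0 - a).
have h0 : 0 < h by rewrite lt_min divr_gt0 // subr_gt0.
have ha : a <= t0 - h by have : h <= t0 - a by [rewrite ge_min lexx orbT]; lra.
have hd : h <= d / 2%:R by rewrite ge_min lexx.
have h2 : 0 < h / 2%:R by rewrite divr_gt0.
have e2 : 0 < e / 2%:R by rewrite divr_gt0.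
have [k k0 kP] := semigroup_near0_totally_bounded C0S contrS
  (semigroup_image_totally_bounded (rint a b nu) h2) e2.
exists (Num.min k (h / 2%:R)); first by rewrite lt_min k0.
move=> g t cg dg /andP[at_ tb']; rewrite lt_min => /andP[tk th].
have [th1 th2] : t0 - h / 2%:R < t /\ t < t0 + h / 2%:R.
  by move: th; rewrite ltr_norml => /andP[]; lra.
pose c := t0 - h; pose z := S (h / 2%:R) (duhamel g a c).
have ct : c <= t by rewrite /c; lra.
have ct0 : c <= t0 by rewrite /c; lra.
have zE s : c + h / 2%:R <= s -> S (s - c) (duhamel g a c) = S (s - c - h / 2%:R) z.
  move=> cs; rewrite /z -(semigroupD C0S) ?(ltW h2) //; last by lra.
  by rewrite subrK.
rewrite (duhamel_split ha ct cg) (duhamel_split ha ct0 cg) !zE; try by rewrite /c; lra.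
set p := S _ z; set q := S _ z; set v := duhamel g c t; set w := duhamel g c t0.
have pq : `|p - q| <= e / 2%:R.
  apply: le_trans (semigroup_dist C0S contrS _ _ _) _; try by rewrite /c; lra.
  apply: kP; last first.
    exists (duhamel g a c) => //=.
    apply: le_trans (dominated_duhamel cg dg (lexx a) _) _; first by lra.
    by apply: rint_nu_le => //; rewrite /c; lra.
  rewrite normr_ge0 /= (_ : _ - _ - _ - _ = t - t0) //; by lra.
have vv : `|v| <= e / 4%:R.
  apply: le_trans (dominated_duhamel cg dg ha tb') _; apply/ltW/dP => //; rewrite /c; lra.
have ww : `|w| <= e / 4%:R.
  apply: le_trans (dominated_duhamel cg dg ha tb) _; apply/ltW/dP => //; rewrite /c; lra.
rewrite opprD addrACA; apply: le_trans (ler_normD _ _) _.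
have := ler_normB v w; lra.
Qed.

End Dominated.

End Duhamel.

(** * Limits along an ultrafilter *)

Lemma sequentially_continuous (R : realType) (E F : normedModType R) (f : E -> F) :
  (forall (x_ : nat -> E) x, x_ n @[n --> \oo] --> x -> f (x_ n) @[n --> \oo] --> f x) ->
  continuous f.
Proof.
move=> sf x; apply: contrapT => nc.
have [e e0 H] : exists2 e : R, 0 < e & forall d : R, 0 < d ->
    exists2 y, `|x - y| < d & e <= `|f x - f y|.
  apply: contrapT => K; apply: nc; apply/cvgrPdist_lt => e e0.
  apply: contrapT => L; apply: K; exists e => // d d0.
  apply: contrapT => K; apply: L; apply/nbhs_ballP; exists d => //= y.
  rewrite -ball_normE /= => xy; rewrite ltNge; apply/negP => le.
  by apply: K; exists y.
have Hn n : exists y, `|x - y| < n.+1%:R^-1 /\ e <= `|f x - f y|.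
  by have [|y xy fxy] := H n.+1%:R^-1; [rewrite invr_gt0 ltr0n | exists y].
have [y yP] := choice Hn.
have yx : y n @[n --> \oo] --> x.
  apply/cvgrPdist_lt => d d0; have /cvgrPdist_lt /(_ _ d0) := @cvg_harmonic R.
  apply: filterS => n; rewrite sub0r normrN /harmonic /= ger0_norm ?invr_ge0 //.
  by have [H1 _] := yP n; apply: lt_trans.
have /cvgrPdist_lt /(_ _ e0) [n _ /(_ n (leqnn n))] /= := sf _ _ yx.
by have [_] := yP n; rewrite leNgt => /negP.
Qed.

Section UltraLimits.
Variables (U : set_system nat) (UU : UltraFilter U).

(** The infinite pigeonhole principle. *)
Lemma ultra_some (T : eqType) (s : seq T) (P : T -> nat -> Prop) :
  (forall n, exists2 y, y \in s & P y n) -> exists2 y, y \in s & U (P y).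
Proof.
move=> H; apply: contrapT => K.
have KU y : y \in s -> U (~` (P y)).
  move=> ys; have [UP|//] := in_ultra_setVsetC (P y) UU.
  by exfalso; apply: K; exists y.
have : U [set n | forall y, y \in s -> ~ P y n].
  elim: s KU {H K} => [_|y s IH KU]; first exact: filterS filterT.
  have Hy := KU y (mem_head _ _).
  have Hs : U [set n | forall y, y \in s -> ~ P y n].
    by apply: IH => z zs; apply: KU; rewrite inE zs orbT.
  apply: filterS (filterI Hy Hs) => n [H1 H2] z; rewrite inE => /orP[/eqP ->//|].
  exact: H2.
move=> /filter_ex [n nP]; have [y ys Py] := H n; exact: nP ys Py.
Qed.

Lemma ultra_cvg (R : realType) (E : completeNormedModType R) (A : set E) (x : nat -> E) :
  totally_bounded A -> (forall n, A (x n)) -> exists l : E, x n @[n --> U] --> l.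
Proof.
move=> tA xA; suff /cvg_ex : cvg (x @ U) by [].
apply: cauchy_cvg; apply: cauchy_exP => e e0.
have [s sP] := tA _ e0.
have [y ys UP] := @ultra_some _ s (fun y n => `|x n - y| < e) (fun n => sP _ (xA n)).
exists y; suff : U [set n | ball y e (x n)] by [].
by apply: filterS UP => n; rewrite /= -ball_normE /= distrC.
Qed.

Lemma ultra_cvg_real (R : realType) (C : R) (x : nat -> R^o) :
  (forall n, `|x n| <= C) -> exists l : R^o, x n @[n --> U] --> l.
Proof.
move=> xC; have UT : U setT by exact: filterT.
have [|l [_ cl]] := @segment_compact R (- C) C (x @ U) _.
  by apply: (@filterS _ U _ _ _ _ UT) => n _; rewrite /= in_itv /= -ler_norml.
exists l => B lB; have [//|nB] := in_ultra_setVsetC (x @^-1` B) UU.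
by have [y [/= yB By]] := cl (~` B) B nB lB.
Qed.

(** The limits of the scalar sequences [phi (v n)] form an element of the
    bidual. *)
Lemma ultra_weak_limit (R : realType) (E : normedModType R) (r : R) (v : nat -> E) :
  reflexive_space E -> (forall n, `|v n| <= r) ->
  exists w : E, forall phi, dual phi -> phi (v n) @[n --> U] --> phi w.
Proof.
move=> reflE vr.
have cv phi : dual phi -> phi (v n) @[n --> U] --> lim (phi (v n) @[n --> U]).
  move=> dphi; have [k [k0 _ kP]] := dual_opnorm dphi.
  have [|l xl] := @ultra_cvg_real R (k * r) (fun n => phi (v n)).
    by move=> n; apply: le_trans (kP _) _; rewrite ler_wpM2l.
  by rewrite (cvg_lim _ xl).
have [|w wP] := reflE (fun phi => lim (phi (v n) @[n --> U])).
  split=> [c phi psi dphi dpsi|].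
    by apply/cvg_lim => //; apply: cvgD; [apply: cvgMr; exact: cv | exact: cv].
  exists r => phi dphi; have [k [k0 -> kP]] := dual_opnorm dphi.
  rewrite -EFinM lee_fin mulrC.
  have H := cvg_norm (cv _ dphi).
  apply: (cvgr_to_le (H _)); apply: (@filterS _ U _ _ _ _ filterT) => n _ /=.
  by apply: le_trans (kP _) _; rewrite ler_wpM2l.
by exists w => phi dphi; rewrite -wP //; exact: cv.
Qed.

End UltraLimits.

(** * The truncated problem *)

Section Clamp.
Variables (R : realType) (a b : R).
Hypothesis ab : a <= b.

Definition clamp (t : R) : R := Num.max a (Num.min t b).

Lemma clamp_id t : a <= t <= b -> clamp t = t.
Proof. by move=> /andP[ta tb]; rewrite /clamp min_l // max_r. Qed.

Lemma clamp_in t : a <= clamp t <= b.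
Proof. by rewrite /clamp le_max lexx /= ge_max ab ge_min lexx orbT. Qed.

Lemma clamp_dist s t : `|clamp s - clamp t| <= `|s - t|.
Proof.
have H (x y e : R) : x - y <= e -> y - x <= e -> `|x - y| <= e.
  by move=> ? ?; rewrite ler_norml; lra.
have D (x y : R) : x - y <= `|x - y| /\ y - x <= `|x - y|.
  by rewrite {2}distrC !ler_norm.
have Hmax (x y e : R) : 0 <= e -> x - y <= e -> y - x <= e ->
    `|Num.max a x - Num.max a y| <= e.
  by move=> e0 xy yx; apply: H; rewrite /Num.max; case: ltP => ?; case: ltP => ?; lra.
have Hmin (x y e : R) : 0 <= e -> x - y <= e -> y - x <= e ->
    `|Num.min x b - Num.min y b| <= e.
  by move=> e0 xy yx; apply: H; rewrite /Num.min; case: ltP => ?; case: ltP => ?; lra.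
have [mst mts] := D (Num.min s b) (Num.min t b); have [st ts] := D s t.
apply: le_trans (Hmax _ _ _ (normr_ge0 _) mst mts) _.
exact: Hmin (normr_ge0 _) st ts.
Qed.

Lemma clamp_continuous : continuous (clamp : R -> R^o).
Proof.
move=> t; apply/cvgrPdist_lt => e e0; apply/nbhs_ballP; exists e => //= s.
by rewrite /ball /= => ts; apply: le_lt_trans (clamp_dist _ _) _.
Qed.

End Clamp.

Section Delay.
Variables (R : realType) (E : completeNormedModType R).
Hypothesis reflE : reflexive_space E.
Variable S : R -> {linear E -> E}.
Hypotheses (C0S : C0_semigroup S) (contrS : contraction_semigroup S).
Hypothesis cptS : compact_semigroup S.
Variables (a b : R) (nu : R -> R).
Hypotheses (ab : a < b) (nu0 : forall s, 0 <= nu s) (inu : integrable_on a b nu).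
Variable F : R -> E -> E.
Hypothesis cF : continuous (fun p : R * E => F p.1 p.2).
Hypothesis dF : {ae @lebesgue_measure R, forall s, s \in `[a, b] ->
  forall x, `|F s x| <= nu s}.

Let leab : a <= b := ltW ab.

Lemma nemytskii_continuous (z : R -> E) :
  continuous z -> continuous (fun s => F s (z s)).
Proof.
move=> cz s; apply: (@continuous_comp _ _ _ (fun s => (s, z s)) (fun p => F p.1 p.2)).
  exact: (cvg_pair (@cvg_id _ _) (cz s)).
exact: cF.
Qed.

Lemma nemytskii_dominated (z : R -> E) : dominated a b nu (fun s => F s (z s)).
Proof. by apply: (ae_imply _ dF) => s H sab; exact: H. Qed.

Lemma duhamel_clamp_continuous g : continuous g -> dominated a b nu g ->
  continuous (fun t => duhamel S g a (clamp a b t)).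
Proof.
move=> cg dg t; apply/cvgrPdist_le => e e0.
have [d d0 dP] := duhamel_equicontinuous reflE C0S contrS leab nu0 inu cptS
  (clamp_in leab t) e0.
apply/nbhs_ballP; exists d => //= s ts; rewrite distrC.
apply: dP => //; first exact: clamp_in.
by apply: le_lt_trans (clamp_dist _ _ _ _) _; rewrite distrC.
Qed.

Definition lag d (s : R) : R := Num.max a (s - d).

Lemma lag_continuous d : continuous (lag d : R -> R^o).
Proof.
move=> s; apply: (@continuous_max R R (fun=> a : R^o) (fun s => s - d : R^o)).
  exact: cvg_cst.
exact: (cvgB (@cvg_id _ _) (cvg_cst _)).
Qed.

Definition delayed_source d (z : R -> E) s := F s (z (lag d s)).

Lemma delayed_source_continuous d z : continuous z -> continuous (delayed_source d z).
Proof.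
move=> cz; apply: (@nemytskii_continuous (z \o lag d)) => s.
by apply: continuous_comp; [exact: lag_continuous | exact: cz].
Qed.

Lemma delayed_source_dominated d z : dominated a b nu (delayed_source d z).
Proof. exact: (nemytskii_dominated (z \o lag d)). Qed.

Definition delay_step d w z t : E :=
  flow S (clamp a b t - a) w + duhamel S (delayed_source d z) a (clamp a b t).

Lemma delay_step_continuous d w z : continuous z -> continuous (delay_step d w z).
Proof.
move=> cz.
have c1 : continuous (fun t => flow S (clamp a b t - a) w).
  apply: continuous_flow => // t; last exact: cvg_cst.
  exact: (cvgB (@clamp_continuous _ _ _ t) (cvg_cst _)).
have c2 := duhamel_clamp_continuous (@delayed_source_continuous d z cz)
  (@delayed_source_dominated d z).
by move=> t; exact: (cvgD (c1 t) (c2 t)).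
Qed.

Lemma delay_step_cvg d (w_ : nat -> E) w (z_ : nat -> R -> E) z :
  w_ n @[n --> \oo] --> w -> (forall n, continuous (z_ n)) -> continuous z ->
  (forall t, z_ n t @[n --> \oo] --> z t) ->
  forall t, delay_step d (w_ n) (z_ n) t @[n --> \oo] --> delay_step d w z t.
Proof.
move=> ww cz_ cz zz t; apply: cvgD.
  rewrite /flow; set h := Num.max _ _.
  have h0 : 0 <= h by rewrite le_max lexx.
  have cS : continuous (S h) by case: C0S => + _ _ _; exact.
  exact: (continuous_cvg _ (cS w) ww).
apply: (duhamel_cvg reflE C0S contrS inu).
- exact: clamp_in.
- by move=> n; exact: delayed_source_continuous.
- exact: delayed_source_continuous.
- by move=> n; exact: delayed_source_dominated.
- exact: delayed_source_dominated.
- move=> s _.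
  have cs : (fun=> s : R) n @[n --> \oo] --> s by exact: cvg_cst.
  have H : (s, z_ n (lag d s)) @[n --> \oo] --> (s, z (lag d s)).
    exact: cvg_pair cs (zz (lag d s)).
  have := continuous_cvg _ (@cF (s, z (lag d s))) H.
  exact.
Qed.

Fixpoint delay_iter d w n : R -> E :=
  if n is n'.+1 then delay_step d w (delay_iter d w n') else fun=> w.

Lemma delay_iter_continuous d w n : continuous (delay_iter d w n).
Proof.
by elim: n => [|n IH]; [move=> t; exact: cvg_cst | exact: delay_step_continuous].
Qed.

Lemma delay_iter_cvg d (w_ : nat -> E) w n : w_ k @[k --> \oo] --> w ->
  forall t, delay_iter d (w_ k) n t @[k --> \oo] --> delay_iter d w n t.
Proof.
move=> ww; elim: n => [|n IH] //= t.
by apply: delay_step_cvg => // [k|]; exact: delay_iter_continuous.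
Qed.

(** By time [a + n d] the [n]-th iterate has reached its final value, since
    each step only looks at the past delayed by [d]. *)
Lemma delay_iter_stable d w n t : 0 <= d -> t <= a + n%:R * d ->
  delay_iter d w n.+1 t = delay_iter d w n t.
Proof.
move=> d0; elim: n t => [|n IH] t.
  rewrite mul0r addr0 => ta /=; rewrite /delay_step.
  have -> : clamp a b t = a.
    by rewrite /clamp max_l // ge_min ta.
  rewrite subrr flowE // (semigroup0 C0S) duhamel_refl ?addr0 //.
  by apply: delayed_source_continuous => s; exact: cvg_cst.
move=> tn; rewrite /= /delay_step; congr (_ + _).
apply: duhamel_eq => //; try by apply: delayed_source_continuous;
  try exact: (@delay_iter_continuous d w n.+1); exact: delay_iter_continuous.
move=> s /andP[as_ st]; rewrite /delayed_source; congr (F s _); apply: (IH (lag d s)).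
have tm : clamp a b t <= Num.max a t.
  by rewrite /clamp ge_max le_max lexx /= le_max !ge_min lexx !orbT.
have nd : 0 <= n%:R * d by rewrite mulr_ge0.
move: tn; rewrite -natr1 mulrDl mul1r => tn.
rewrite /lag ge_max lerDl nd /=.
have : s <= Num.max a t by apply: le_trans st tm.
rewrite le_max => /orP[sa|]; lra.
Qed.

Definition delay n : R := (b - a) / n.+1%:R.

(** The solution of the delayed equation with initial value [w]. *)
Definition delayed n w : R -> E := delay_iter (delay n) w n.+1.

Lemma delayed_continuous n w : continuous (delayed n w).
Proof. exact: delay_iter_continuous. Qed.

Lemma delayed_cvg n (w_ : nat -> E) w : w_ k @[k --> \oo] --> w ->
  forall t, delayed n (w_ k) t @[k --> \oo] --> delayed n w t.
Proof. exact: delay_iter_cvg. Qed.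

Lemma delayedE n w t : a <= t <= b ->
  delayed n w t = S (t - a) w + duhamel S (delayed_source (delay n) (delayed n w)) a t.
Proof.
move=> tab; have [ta tb] := andP tab.
have d0 : 0 <= delay n by rewrite divr_ge0 // subr_ge0.
rewrite -flowE ?subr_ge0 // -(clamp_id tab) -/(delay_step _ _ _ _).
rewrite -[RHS]/(delay_iter (delay n) w n.+2 t) delay_iter_stable //.
  by rewrite clamp_id.
by rewrite /delay mulrC divfK ?pnatr_eq0 // addrC subrK.
Qed.

Let rho n : R := n.+1%:R^-1.

Let rho0 n : 0 < rho n. Proof. by rewrite invr_gt0 ltr0n. Qed.

Let rho_small e : 0 < e -> \forall n \near \oo, rho n < e.
Proof.
move=> e0; have /cvgrPdist_lt /(_ _ e0) := @cvg_harmonic R.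
by apply: filterS => n; rewrite sub0r normrN /harmonic /= ger0_norm ?invr_ge0.
Qed.

(** Pointwise limits along an ultrafilter exist by compactness, strong ones for the
    integrals, and a weak one for [v] that [S s] turns into a strong one for
    [s > 0].  A subsequence with the same limits is extracted by asking at stage
    [m] for closeness on a finite grid of mesh [1 / (m + 1)] and for
    [s = 1 / (m + 1)] only: equicontinuity and contractivity do the rest.  The times
    are allowed to vary with [n], as the delays will. *)
Lemma mild_compactness (g : nat -> R -> E) (v : nat -> E) (r : R) :
  (forall n, continuous (g n)) -> (forall n, dominated a b nu (g n)) ->
  (forall n, `|v n| <= r) ->
  exists (sigma : nat -> nat) (w0 : E) (L : R -> E),
  [/\ forall n, (n <= sigma n)%N,
      forall (s_ : nat -> R) (s : R), 0 < s -> s_ n @[n --> \oo] --> s ->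
        flow S (s_ n) (v (sigma n)) @[n --> \oo] --> S s w0,
      continuous (fun t => L (clamp a b t)) &
      forall (t_ : nat -> R) (t : R), a <= t <= b -> (forall n, a <= t_ n <= b) ->
        t_ n @[n --> \oo] --> t ->
        duhamel S (g (sigma n)) a (t_ n) @[n --> \oo] --> L t].
Proof.
move=> cg dg vr.
(* U refines the filter of cofinite sets, so sets of U contain large indices. *)
have [U [UU Uoo]] := @ultraFilterLemma nat \oo _.
have [L LP] : exists L : R -> E, forall t, a <= t <= b ->
    duhamel S (g n) a t @[n --> U] --> L t.
  have H t : exists l : E, a <= t <= b -> duhamel S (g n) a t @[n --> U] --> l.
    have [tab|tab] := boolP (a <= t <= b); last by exists 0.
    have [l lP] := ultra_cvg UU (x := fun n => duhamel S (g n) a t)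
      (duhamel_totally_bounded reflE C0S contrS leab nu0 inu cptS tab)
      (fun n => ex_intro2 _ _ (g n) (conj (cg n) (dg n)) erefl).
    by exists l.
  by have [L LP] := choice H; exists L.
have [w0 w0P] := ultra_weak_limit UU reflE vr.
have SP (s : R) : 0 < s -> S s (v n) @[n --> U] --> S s w0.
  move=> s0; have cS : continuous (S s) by case: C0S => + _ _ _; apply; exact: ltW.
  have [l lP] := ultra_cvg UU (x := fun n => S s (v n))
    (@semigroup_image_totally_bounded _ _ _ cptS s r s0)
    (fun n => ex_intro2 _ _ (v n) (vr n) erefl).
  (* The strong limit and the image of the weak limit agree on functionals. *)
  suff <- : l = S s w0 by [].
  apply: dual_separates => phi [lphi cphi].
  have dS : dual (phi \o S s : E -> R^o).
    split=> [k x y|x]; first by rewrite /= linearP lphi.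
    by apply: continuous_comp; [exact: cS | exact: cphi].
  have H1 : phi (S s (v n)) @[n --> U] --> phi l by exact: (continuous_cvg _ (cphi l) lP).
  have H2 : phi (S s (v n)) @[n --> U] --> phi (S s w0) by exact: w0P dS.
  exact: (cvg_unique _ H1 H2).
have stage m : exists n, [/\ (m <= n)%N,
    `|S (rho m) (v n) - S (rho m) w0| <= rho m &
    forall t, a <= t <= b ->
      `|duhamel S (g n) a (node a m (cell_of a m t)) - L (node a m (cell_of a m t))| <= rho m].
  have U1 : U [set n | (m <= n)%N] by apply: Uoo; exists m.
  have U2 : U [set n | `|S (rho m) (v n) - S (rho m) w0| <= rho m].
    have /cvgrPdist_le /(_ _ (rho0 m)) := SP _ (rho0 m).
    by apply: filterS => n; rewrite distrC.
  have U3 : U [set n | forall i : 'I_(cells a b m), node a m i <= b ->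
      `|duhamel S (g n) a (node a m i) - L (node a m i)| <= rho m].
    apply: (@filter_forall _ _ (fun (i : 'I_(cells a b m)) => [set n | node a m i <= b ->
      `|duhamel S (g n) a (node a m i) - L (node a m i)| <= rho m])) => i.
    have [ib|ib] := boolP (node a m i <= b); last first.
      by apply: (@filterS _ U _ _ _ _ filterT) => n _.
    have iab : a <= node a m i <= b by rewrite ib lerDl divr_ge0.
    have /cvgrPdist_le /(_ _ (rho0 m)) := LP _ iab.
    by apply: filterS => n H _; rewrite distrC.
  have [n [[n1 n2] n3]] := filter_ex (filterI (filterI U1 U2) U3).
  exists n; split => // t tab.
  apply: (n3 (Ordinal (cell_of_lt m tab))) => /=.
  have : t \in cell a b m (cell_of a m t) by rewrite cellP.
  rewrite inE => -[_]; rewrite /= in_itv /= => /andP[l1 _].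
  by apply: le_trans l1 _; case/andP: tab.
(* Stage m fixes the m-th term of the subsequence. *)
have [sigma sP] := choice stage.
have equi t0 e : a <= t0 <= b -> 0 < e -> exists2 d : R, 0 < d &
    (forall n t, a <= t <= b -> `|t - t0| < d ->
      `|duhamel S (g n) a t - duhamel S (g n) a t0| <= e) /\
    forall t, a <= t <= b -> `|t - t0| < d -> `|L t - L t0| <= e.
  move=> tab e0.
  have [d d0 dP] := duhamel_equicontinuous reflE C0S contrS leab nu0 inu cptS tab e0.
  exists d => //; split => [n t|t tab' tt]; first exact: dP.
  have H : `|duhamel S (g n) a t - duhamel S (g n) a t0| @[n --> U] --> `|L t - L t0|.
    exact: cvg_norm (cvgB (LP _ tab') (LP _ tab)).
  apply: (cvgr_to_le H); apply: (@filterS _ U _ _ _ _ filterT) => n _.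
  exact: dP.
have Lcvg (t_ : nat -> R) (t : R) : a <= t <= b -> (forall n, a <= t_ n <= b) ->
    t_ n @[n --> \oo] --> t -> duhamel S (g (sigma n)) a (t_ n) @[n --> \oo] --> L t.
  move=> tab tab_ tt; apply/cvgrPdist_le => e e0.
  have e4 : 0 < e / 4%:R by rewrite divr_gt0.
  have [d d0 [dg_ dL]] := equi t _ tab e4.
  have /cvgrPdist_lt /(_ _ d0) H1 := tt.
  apply: filterS (filterI H1 (filterI (rho_small d0) (rho_small e4))) => n [h1 [h2 h3]].
  (* Compare at the grid point q next to t, where stage n gives closeness. *)
  set q := node a n (cell_of a n t).
  have /andP[aq qt] : a <= q <= t.
    have : t \in cell a b n (cell_of a n t) by rewrite cellP.
    rewrite inE => -[_]; rewrite /= in_itv /= => /andP[l1 _]; rewrite l1 andbT.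
    by rewrite lerDl divr_ge0.
  have qab : a <= q <= b by rewrite aq (le_trans qt) //; case/andP: tab.
  have qd : `|q - t| < d by rewrite distrC; apply: le_lt_trans (node_close n tab) h2.
  have k1 := dg_ (sigma n) (t_ n) (tab_ n); have k2 := dg_ (sigma n) q qab qd.
  have k3 := dL q qab qd; have [_ _ /(_ t tab)] := sP n; rewrite -/q => k4.
  have {}k1 : `|duhamel S (g (sigma n)) a (t_ n) - duhamel S (g (sigma n)) a t| <= e / 4%:R.
    by apply: k1; rewrite distrC.
  move: k1 k2 k3 k4; set A := duhamel _ _ _ (t_ n); set B := duhamel _ _ _ t.
  set C := duhamel _ _ _ q; move=> k1 k2 k3 k4.
  apply: le_trans (ler_distD (L q) _ _) _.
  move: (L t) (L q) A B C k1 k2 k3 k4 => Lt Lq A B C k1 k2 k3 k4.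
  have := ler_distD C Lq A; have := ler_distD B C A.
  by rewrite [`|Lt - Lq|]distrC [`|Lq - C|]distrC [`|B - A|]distrC; lra.
have Scvg (s_ : nat -> R) (s : R) : 0 < s -> s_ n @[n --> \oo] --> s ->
    flow S (s_ n) (v (sigma n)) @[n --> \oo] --> S s w0.
  move=> s0 ss; apply/cvgrPdist_le => e e0.
  have e2 : 0 < e / 2%:R by rewrite divr_gt0.
  have s2 : 0 < s / 2%:R by rewrite divr_gt0.
  have cw : flow S (s_ n) w0 @[n --> \oo] --> flow S s w0.
    have H : (s_ n, w0) @[n --> \oo] --> (s, w0) by exact: cvg_pair ss (cvg_cst w0).
    exact: (continuous_cvg _ (@flow_continuous _ _ _ C0S contrS (s, w0)) H).
  move: cw => /cvgrPdist_lt /(_ _ e2) H1; have /cvgrPdist_lt /(_ _ s2) H2 := ss.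
  apply: filterS (filterI (filterI H1 H2) (filterI (rho_small s2) (rho_small e2))).
  move=> n [[h1 h2] [h3 h4]].
  have rs_ : rho n <= s_ n by move: h2; rewrite ltr_norml => /andP[]; lra.
  have s_0 : 0 <= s_ n by apply: le_trans rs_; exact: ltW.
  have sp := ltW s0; move: h1; rewrite !flowE // => h1.
  apply: le_trans (ler_distD (S (s_ n) w0) _ _) _.
  have [_ k _] := sP n.
  suff : `|S (s_ n) w0 - S (s_ n) (v (sigma n))| <= rho n by lra.
  apply: le_trans k; rewrite distrC -!linearB -{1}(subrK (rho n) (s_ n)).
  rewrite (semigroupD C0S) ?subr_ge0 ?(ltW (rho0 n)) //.
  by apply: semigroup_contr => //; rewrite subr_ge0.
exists sigma, w0, L; split => //; first by move=> n; case: (sP n).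
move=> t; apply/cvgrPdist_le => e e0.
have [d d0 [_ dL]] := equi _ _ (clamp_in leab t) e0.
apply/nbhs_ballP; exists d => //= s ts; rewrite distrC.
apply: dL => //; first exact: clamp_in.
by apply: le_lt_trans (clamp_dist _ _ _ _) _; rewrite distrC.
Qed.

Section FixedPoint.
Variables (N : (R -> E) -> E) (r : R).
Hypothesis N_bound : forall z, continuous z -> `|N z| <= r.
Hypothesis N_cvg : forall (z_ : nat -> R -> E) z, (forall n, continuous (z_ n)) ->
  continuous z -> (forall t, a < t <= b -> z_ n t @[n --> \oo] --> z t) ->
  N (z_ n) @[n --> \oo] --> N z.

Lemma delayed_approximate_solution n :
  exists w, `|S (rho n) (N (delayed n w)) - w| <= rho n.
Proof.
have cS : continuous (S (rho n)) by case: C0S => + _ _ _; apply; exact: ltW.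
apply: (@approximate_fixed_point R E (fun w => S (rho n) (N (delayed n w)))) => //.
  apply: sequentially_continuous => w_ w ww.
  have H : N (delayed n (w_ k)) @[k --> \oo] --> N (delayed n w).
    by apply: N_cvg => [k||t _]; [exact: delayed_continuous..|exact: delayed_cvg].
  exact: (continuous_cvg _ (cS _) H).
have bB : bounded_set [set x : E | `|x| <= r].
  by exists r; split; [exact: num_real | move=> y ry x /= xr; apply: le_trans xr (ltW ry)].
apply: precompact_subset (cptS (rho0 n) bB) => _ [w _ <-].
exists (N (delayed n w)) => //=; apply: N_bound; exact: delayed_continuous.
Qed.

Theorem truncated_problem : exists z : R -> E, continuous z /\
  forall t, a <= t <= b ->
    z t = S (t - a) (N z) + duhamel S (fun s => F s (z s)) a t.
Proof.
have [w wP] := choice delayed_approximate_solution.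
pose z n := delayed n (w n); pose v n := N (z n).
pose g n := delayed_source (delay n) (z n).
have cz n : continuous (z n) by exact: delayed_continuous.
have vr n : `|v n| <= r by apply: N_bound; exact: cz.
have cg n : continuous (g n) by exact: delayed_source_continuous.
have dg n : dominated a b nu (g n) by exact: delayed_source_dominated.
have [sigma [w0 [L [sm Scvg cL Lcvg]]]] := mild_compactness cg dg vr.
have rs m : rho (sigma m) <= rho m.
  by rewrite lef_pV2 ?posrE ?ltr0n // ler_nat ltnS.
(* The limit function, continuous at a because w0 is a vector of E. *)
pose y t := flow S (clamp a b t - a) w0 + L (clamp a b t).
have cy : continuous y.
  have c1 : continuous (fun t => flow S (clamp a b t - a) w0).
    apply: continuous_flow => // t; last exact: cvg_cst.
    exact: (cvgB (@clamp_continuous _ _ _ t) (cvg_cst _)).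
  by move=> t; exact: (cvgD (c1 t) (cL t)).
have zcvg (t_ : nat -> R) (t : R) : a < t <= b -> (forall n, a <= t_ n <= b) ->
    t_ n @[n --> \oo] --> t -> z (sigma n) (t_ n) @[n --> \oo] --> y t.
  move=> /andP[at_ tb] tab_ tt; have tab : a <= t <= b by rewrite ltW.
  have r0 : rho (sigma n) @[n --> \oo] --> (0 : R).
    apply/cvgrPdist_lt => e e0; apply: filterS (rho_small e0) => n h.
    by rewrite sub0r normrN gtr0_norm //; apply: le_lt_trans h.
  have ss : t_ n - a + rho (sigma n) @[n --> \oo] --> t - a.
    rewrite -[t - a]addr0; apply: cvgD r0; apply: cvgB tt _; exact: cvg_cst.
  have sta : 0 < t - a by rewrite subr_gt0.
  have K : flow S (t_ n - a + rho (sigma n)) (v (sigma n)) @[n --> \oo]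
      --> S (t - a) w0 by exact: Scvg sta ss.
  have H : S (t_ n - a) (w (sigma n)) @[n --> \oo] --> S (t - a) w0.
    apply/cvgrPdist_lt => e e0.
    have e2 : 0 < e / 2%:R by rewrite divr_gt0.
    have /cvgrPdist_lt /(_ _ e2) K1 := K.
    apply: filterS (filterI K1 (rho_small e2)) => n [h1 h2].
    have ta_ : 0 <= t_ n - a by rewrite subr_ge0; case/andP: (tab_ n).
    have rn := ltW (rho0 (sigma n)).
    have {}h1 : `|S (t - a) w0 - S (t_ n - a) (S (rho (sigma n)) (v (sigma n)))| < e / 2%:R.
      by rewrite -(semigroupD C0S) //; move: h1; rewrite flowE // addr_ge0.
    apply: le_lt_trans (ler_distD (S (t_ n - a) (S (rho (sigma n)) (v (sigma n)))) _ _) _.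
    have : `|S (t_ n - a) (S (rho (sigma n)) (v (sigma n))) - S (t_ n - a) (w (sigma n))|
        <= rho n.
      rewrite -linearB; apply: le_trans (semigroup_contr contrS _ ta_) _.
      exact: le_trans (wP (sigma n)) (rs n).
    by lra.
  have -> : y t = S (t - a) w0 + L t by rewrite /y clamp_id // flowE // subr_ge0 ltW.
  have zE : (fun n => z (sigma n) (t_ n)) =
      (fun n => S (t_ n - a) (w (sigma n)) + duhamel S (g (sigma n)) a (t_ n)).
    by apply/funext => n; rewrite /z delayedE.
  by rewrite zE; apply: cvgD H _; exact: Lcvg.
have vN : v (sigma n) @[n --> \oo] --> N y.
  apply: N_cvg => // t tab; apply: (zcvg (fun=> t)) => //; last exact: cvg_cst.
  by move=> _; case/andP: tab => /ltW -> ->.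
(* Both vectors have the same image under S s for all s > 0; let s tend to 0. *)
have w0N : w0 = N y.
  have SS (s : R) : 0 < s -> S s w0 = S s (N y).
    move=> s0; have cS : continuous (S s) by case: C0S => + _ _ _; apply; exact: ltW.
    have H1 : S s (v (sigma n)) @[n --> \oo] --> S s w0.
      have -> : (fun n => S s (v (sigma n))) = (fun n => flow S s (v (sigma n))).
        by apply/funext => n; rewrite flowE // ltW.
      exact: (Scvg (fun=> s) s s0 (cvg_cst s)).
    have H2 : S s (v (sigma n)) @[n --> \oo] --> S s (N y).
      exact: (continuous_cvg _ (cS _) vN).
    exact: (cvg_unique _ H1 H2).
  apply/eqP; rewrite -subr_eq0 -normr_le0; apply/ler_addgt0Pl => e e0; rewrite addr0.
  have e2 : 0 < e / 2%:R by rewrite divr_gt0.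
  have [d d0 dP] := semigroup_near0 C0S w0 e2.
  have [d' d'0 d'P] := semigroup_near0 C0S (N y) e2.
  pose h := Num.min d d' / 2%:R.
  have m0 : 0 < Num.min d d' by rewrite lt_min d0.
  have h0 : 0 < h by rewrite divr_gt0.
  have hm : h < Num.min d d' by rewrite /h; lra.
  move: hm; rewrite lt_min => /andP[hd hd'].
  apply: le_trans (ler_distD (S h w0) _ _) _; rewrite {2}SS // distrC.
  have := dP h; have := d'P h; rewrite hd hd' (ltW h0) => /(_ isT) k1 /(_ isT) k2.
  by lra.
exists y; split => // t tab; have [ta tb] := andP tab.
have -> : y t = S (t - a) w0 + L t by rewrite /y clamp_id // flowE ?subr_ge0.
rewrite -w0N; congr (_ + _).
have H1 : duhamel S (g (sigma n)) a t @[n --> \oo] --> L t.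
  by apply: (Lcvg (fun=> t)) => //; exact: cvg_cst.
have H2 : duhamel S (g (sigma n)) a t @[n --> \oo] -->
    duhamel S (fun s => F s (y s)) a t.
  apply: (duhamel_cvg reflE C0S contrS inu tab) => //.
  - exact: nemytskii_continuous.
  - exact: nemytskii_dominated.
  move=> s sab; have [as_ sb] := andP sab.
  have K : z (sigma n) (lag (delay (sigma n)) s) @[n --> \oo] --> y s.
    apply: zcvg => // [n|].
      rewrite /lag le_max lexx /= ge_max leab /=; apply: le_trans sb.
      by rewrite lerBlDr lerDl divr_ge0 // subr_ge0.
    apply/cvgrPdist_le => e e0.
    have eb : 0 < e / (b - a) by rewrite divr_gt0 // subr_gt0.
    apply: filterS (rho_small eb) => n; rewrite ltr_pdivlMr ?subr_gt0 // => h.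
    have dn : delay (sigma n) <= e.
      rewrite /delay mulrC; apply: le_trans (ltW h).
      by rewrite ler_pM2r ?subr_gt0 //; exact: rs.
    have d0 : 0 <= delay (sigma n) by rewrite divr_ge0 // subr_ge0.
    by rewrite /lag /Num.max; case: ltP => ?; rewrite ger0_norm; lra.
  have H : (s, z (sigma n) (lag (delay (sigma n)) s)) @[n --> \oo] --> (s, y s).
    exact: cvg_pair (cvg_cst s) K.
  have := continuous_cvg _ (@cF (s, y s)) H.
  exact.
exact: (cvg_unique _ H1 H2).
Qed.

End FixedPoint.

End Delay.

(** * Bounding functions and the radial retraction *)

Section Bounding.
Variables (R : realType) (E : normedModType R).
Implicit Types (x y : E) (r : R).

Lemma sphere_boundary r x : 0 < r -> `|x| = r -> boundary (ball (0 : E) r) x.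
Proof.
move=> r0 xr; split; last first.
  rewrite (iffLR (interior_id _)); last exact: ball_open.
  by rewrite -ball_normE /= sub0r normrN xr ltxx.
move=> B /nbhs_ballP[e /= e0 eB].
pose s := Num.min (1 / 2%:R) (e / (2%:R * r)).
have r2 : 0 < 2%:R * r by rewrite mulr_gt0.
have s0 : 0 < s by rewrite lt_min !divr_gt0.
have s1 : s <= 1 / 2%:R by rewrite ge_min lexx.
have se : s * r < e.
  apply: (@le_lt_trans _ _ (e / (2%:R * r) * r)).
    by rewrite ler_pM2r // ge_min lexx orbT.
  rewrite invfM mulrA mulfVK ?gt_eqF //; lra.
exists ((1 - s) *: x); split.
  rewrite -ball_normE /= sub0r normrN normrZ xr ger0_norm; last by lra.
  by rewrite gtr_pMl //; lra.
apply: eB; rewrite -ball_normE /= scalerBl scale1r opprB addrC subrK.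
by rewrite normrZ xr gtr0_norm.
Qed.

(** By convexity the growth rate of the norm along a ray is nondecreasing. *)
Lemma outward_convex x y r c k k' : `|x| = r -> 0 < k' -> k' <= k ->
  r + c * k' <= `|x - k' *: y| -> r + c * k <= `|x - k *: y|.
Proof.
move=> xr k'0 k'k; have k0 : 0 < k by apply: lt_le_trans k'k.
have [th [th0 th1 kth]] : exists th, [/\ 0 < th, th <= 1 & th * k = k'].
  exists (k' / k); rewrite divr_gt0 // ler_pdivrMr // mul1r mulfVK //.
  by rewrite gt_eqF.
have -> : x - k' *: y = (1 - th) *: x + th *: (x - k *: y).
  by rewrite scalerBr scalerA kth addrA scalerBl scale1r subrK.
move=> /le_trans /(_ (ler_normD _ _)); rewrite !normrZ xr ger0_norm ?subr_ge0 //.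
rewrite gtr0_norm // -kth => H.
rewrite -(ler_pM2l th0) (_ : th * (r + c * k) = r + c * (th * k) - (1 - th) * r).
  by rewrite lerBlDl.
by ring.
Qed.

(** The condition on [V] gives arbitrarily small [k] with
    [V (x - k f) > c k > 0], so [x - k f] is outside the ball.  Comparing with its
    radial projection, where [V] vanishes, the Lipschitz bound turns this into a lower
    bound for the norm, and [outward_convex] extends it to all [k > 0]. *)
Lemma bounding_function_outward (f : R -> E -> E) (a b r : R) (V : E -> R) t x :
  0 < r -> @locally_lipschitz R E R^o V -> bounding_function f a b (ball (0 : E) r) V ->
  t \in `]a, b] -> `|x| = r ->
  exists2 c : R, 0 < c & forall k, 0 < k -> r + c * k <= `|x - k *: f t x|.
Proof.
move=> r0 lipV [_ [V0 Vle] Vlim] tab xr; set y := f t x.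
(* With h = - k the lower limit at 0- gives values above c k for small k. *)
have [c c0 cP] : exists2 c : R, 0 < c & forall d : R, 0 < d ->
    exists k, [/\ 0 < k, k < d & c * k < V (x - k *: y)].
  have := Vlim t x tab (sphere_boundary r0 xr); rewrite -/y limf_einfE => lim0.
  have [c c0 cl] : exists2 c : R, 0 < c &
     (ereal_sup [set ereal_inf [set (V (x + h *: y) / h)%:E | h in W]
        | W in (0 : R)^'-] < (- c)%:E)%E.
    move: lim0; case: (ereal_sup _) => [l| |] //.
      by rewrite lte_fin => l0; exists (- l / 2%:R); rewrite ?lte_fin; lra.
    by exists 1; rewrite ?ltNyr.
  exists c => // d d0.
  have Wd : (0 : R)^'- [set h | - d < h < 0].
    exists d => //= h; rewrite /ball /= sub0r normrN => hd h0.
    by move: hd; rewrite ltr_norml h0 => /andP[-> _].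
  have : (ereal_inf [set (V (x + h *: y) / h)%:E | h in [set h | (- d < h < 0)%R]]
      < (- c)%:E)%E.
    apply: le_lt_trans cl; apply: ereal_sup_ubound.
    by exists [set h | - d < h < 0].
  move=> /ereal_inf_lt[_ [h /andP[dh h0] <-]]; rewrite lte_fin => Vh.
  exists (- h); split; [lra|lra|].
  rewrite scaleNr opprK; have hn : h != 0 by rewrite lt_eqF.
  have : V (x + h *: y) / h * h > - c * h by rewrite ltr_nM2r.
  by rewrite mulfVK //; lra.
have [U Ux /= lipU] := lipV x.
have [L L0 LP] : exists2 L : R, 0 < L & forall u v, U u -> U v -> `|V u - V v| <= L * `|u - v|.
  case: lipU => M0 [_ MP]; exists (Num.max M0 0 + 1).
    by rewrite ltr_pwDr // le_max lexx orbT.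
  have HM : M0 < Num.max M0 0 + 1 by rewrite ltr_pwDr // le_max lexx.
  by move=> u v Uu Uv; have := MP _ HM (u, v) (conj Uu Uv).
have [e /= e0 eU] : exists2 e : R, 0 < e & ball x e `<=` U by have /nbhs_ballP := Ux.
exists (c / L); first exact: divr_gt0.
move=> k k0.
(* For times up to d, x - k' y and its projection stay in the ball of radius e
   where V is Lipschitz. *)
pose d := Num.min k (e / (2%:R * (`|y| + 1))).
have y1 : 0 < `|y| + 1 by rewrite ltr_wpDl.
have y2 : 0 < 2%:R * (`|y| + 1) by rewrite mulr_gt0.
have d0 : 0 < d by rewrite lt_min k0 divr_gt0.
have [k' [k'0 k'd Vk']] := cP d d0.
move: k'd; rewrite lt_min => /andP[k'k]; rewrite ltr_pdivlMr // => k'e.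
apply: (@outward_convex x y r _ k k') => //; first exact: ltW.
set u := x - k' *: y.
have xu : `|x - u| < e / 2%:R.
  rewrite /u opprB addrC subrK normrZ gtr0_norm //.
  have : k' * `|y| <= k' * (`|y| + 1) by rewrite ler_pM2l // lerDl.
  lra.
have Vu : 0 < V u by apply: lt_trans Vk'; rewrite mulr_gt0.
have ur : r < `|u|.
  rewrite ltNge; apply/negP; rewrite le_eqVlt => /orP[/eqP ur|ur].
    by have := V0 _ (sphere_boundary r0 ur); move: Vu => /[swap] ->; rewrite ltxx.
  have := Vle u; rewrite -ball_normE /= sub0r normrN => /(_ ur).
  by rewrite leNgt Vu.
have u0 : 0 < `|u| by apply: lt_trans ur.
pose v := (r / `|u|) *: u.
have vr : `|v| = r by rewrite normrZ gtr0_norm ?divr_gt0 // mulfVK // gt_eqF.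
have uv : `|u - v| = `|u| - r.
  rewrite -{1}[u]scale1r -scalerBl normrZ ger0_norm; last first.
    by rewrite subr_ge0 ler_pdivrMr // mul1r ltW.
  by rewrite mulrBl mul1r mulfVK // gt_eqF.
have xu2 : `|u| - r <= `|x - u|.
  rewrite lerBlDr -xr; have := ler_distD x u 0.
  by rewrite !subr0 distrC.
have Uu : U u by apply: eU; rewrite -ball_normE /=; lra.
have Uv : U v.
  apply: eU; rewrite -ball_normE /=; apply: le_lt_trans (ler_distD u _ _) _.
  by rewrite uv; lra.
have := LP u v Uu Uv; rewrite (V0 v (sphere_boundary r0 vr)) subr0 gtr0_norm // uv.
move=> VL; rewrite mulrAC -lerBrDl ler_pdivrMr // [leRHS]mulrC.
by apply: le_trans VL; exact: ltW.
Qed.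

Definition retraction r x : E := (r / Num.max r `|x|) *: x.

Lemma retraction_id r x : 0 < r -> `|x| <= r -> retraction r x = x.
Proof. by move=> r0 xr; rewrite /retraction max_l // divff ?scale1r // gt_eqF. Qed.

Lemma retraction_out r x : r <= `|x| -> retraction r x = (r / `|x|) *: x.
Proof. by move=> rx; rewrite /retraction max_r. Qed.

Lemma retraction_le r x : 0 < r -> `|retraction r x| <= r.
Proof.
move=> r0; have [xr|/ltW rx] := leP `|x| r; first by rewrite retraction_id.
have x0 : 0 < `|x| by apply: lt_le_trans rx.
by rewrite retraction_out // normrZ gtr0_norm ?divr_gt0 // mulfVK // gt_eqF.
Qed.

Lemma retraction_continuous r : 0 < r -> continuous (retraction r).
Proof.
move=> r0 x.
have m0 y : Num.max r `|y| != 0 by rewrite gt_eqF // lt_max r0.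
have cm : Num.max r `|y| @[y --> x] --> (Num.max r `|x| : R^o).
  have cn : {for x, continuous (fun y : E => `|y| : R^o)} by exact: norm_continuous.
  exact: (continuous_max (@cst_continuous _ R^o r x) cn).
exact: (cvgZ (cvgM (cvg_cst r) (cvgV (m0 x) cm)) (@cvg_id _ _)).
Qed.

End Bounding.

(** * A priori bound and main theorem *)

(** The retraction freezes the source along rays outside the ball, so the
    inequality on the sphere is needed at all multiples of its points. *)
Lemma outward_scale (R : realType) (E : normedModType R) (x y : E) (r c al : R) :
  0 < al -> `|x| = r ->
  (forall k, 0 < k -> r + c * k <= `|x - k *: y|) ->
  forall k, 0 < k -> `|al *: x| + c * k <= `|al *: x - k *: y|.
Proof.
move=> al0 xr H k k0.
have -> : al *: x - k *: y = al *: (x - (k / al) *: y).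
  by rewrite scalerBr scalerA mulrCA divff ?mulr1 // gt_eqF.
rewrite !normrZ gtr0_norm // xr.
have -> : al * r + c * k = al * (r + c * (k / al)).
  by rewrite mulrDr mulrCA [al * (k / al)]mulrCA divff ?mulr1 // gt_eqF.
by rewrite ler_pM2l //; apply: H; exact: divr_gt0.
Qed.

Section APriori.
Variables (R : realType) (E : completeNormedModType R).
Hypothesis reflE : reflexive_space E.
Variable S : R -> {linear E -> E}.
Hypotheses (C0S : C0_semigroup S) (contrS : contraction_semigroup S).

(** First order expansion from the left, by continuity of the integrand. *)
Lemma duhamel_expansion (g : R -> E) t eta : continuous g -> 0 < eta ->
  exists2 d : R, 0 < d & forall k, 0 < k -> k < d ->
    `|duhamel S g (t - k) t - k *: g t| <= eta * k.
Proof.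
move=> cg eta0; pose u s := flow S (t - s) (g s).
have cu : continuous u by exact: duhamel_integrand_continuous.
have ut : u t = g t by rewrite /u subrr flowE // semigroup0.
have /cvgrPdist_le /(_ _ eta0) /nbhs_ballP[d /= d0 dP] := cu t.
exists d => // k k0 kd.
have tk : t - k <= t by lra.
have -> : k *: g t = vint (t - k) t (fun=> g t).
  by rewrite vint_cst // opprB addrC subrK.
rewrite /duhamel vintB //; last by move=> z; exact: cvg_cst.
have -> : eta * k = eta * (t - (t - k)) by rewrite opprB addrC subrK.
apply: vint_le => // [z|s /andP[ks st]].
  exact: cvgB (cu z) (cvg_cst _).
rewrite -ut distrC; apply: dP; rewrite /ball /= ger0_norm; lra.
Qed.

(** At a maximum of the norm above [r] the solution would have been larger
    shortly before. *)
Lemma mild_norm_bound (a b r : R) (g z : R -> E) (w : E) : a < b ->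
  continuous g -> continuous z -> `|w| <= r ->
  (forall t, a <= t <= b -> z t = S (t - a) w + duhamel S g a t) ->
  (forall t, a < t <= b -> r < `|z t| ->
    exists2 c : R, 0 < c & forall k, 0 < k -> `|z t| + c * k <= `|z t - k *: g t|) ->
  forall t, a <= t <= b -> `|z t| <= r.
Proof.
move=> ab cg cz wr zE out t tab; have ab' := ltW ab.
have cn : {within `[a, b], continuous (fun s => `|z s|)}.
  by apply: continuous_subspaceT => s; exact: cvg_norm (cz s).
have [m + mmax] := @EVT_max R (fun s => `|z s|) a b ab' cn.
rewrite in_itv /= => mab.
have mmax' s : a <= s <= b -> `|z s| <= `|z m|.
  by move=> sab; apply: mmax; rewrite in_itv.
apply: le_trans (mmax' t tab) _; rewrite leNgt; apply/negP => rm.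
have [am mb] := andP mab.
have am' : a < m.
  rewrite lt_neqAle am andbT; apply/eqP => e; move: rm; rewrite -e zE ?lexx //.
  by rewrite subrr semigroup0 // duhamel_refl // addr0 ltNge wr.
have [c c0 cP] : exists2 c : R, 0 < c & forall k, 0 < k ->
    `|z m| + c * k <= `|z m - k *: g m| by apply: out; rewrite ?am'.
have c2 : 0 < c / 2%:R by rewrite divr_gt0.
have [d d0 dP] := duhamel_expansion m cg c2.
pose k := Num.min (d / 2%:R) (m - a).
have k0 : 0 < k by rewrite lt_min divr_gt0 // subr_gt0.
have kd : k < d by have : k <= d / 2%:R by [rewrite ge_min lexx]; lra.
have ka : k <= m - a by rewrite ge_min lexx orbT.
have mk : a <= m - k by lra.
have km : m - k <= m by lra.
have mkab : a <= m - k <= b by rewrite mk /=; lra.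
have zm : z m - k *: g m = S k (z (m - k)) + (duhamel S g (m - k) m - k *: g m).
  rewrite (zE m mab) (zE _ mkab) linearD -semigroupD ?subr_ge0 ?(ltW k0) //.
  have -> : k + (m - k - a) = m - a by lra.
  rewrite (duhamel_split reflE C0S contrS mk km cg) (_ : m - (m - k) = k); last by lra.
  by rewrite !addrA.
have := cP k k0; rewrite zm => /le_trans /(_ (ler_normD _ _)).
have := dP k k0 kd; have := semigroup_contr contrS (z (m - k)) (ltW k0).
have := mmax' _ mkab; have : 0 < c / 2%:R * k by rewrite mulr_gt0.
rewrite mulrAC.
lra.
Qed.

End APriori.

Theorem theorem3p1 (R : realType) (E : completeNormedModType R)
  (reflE : reflexive_space E)
  (a b : R) (ab : a < b)
  (D : set E) (A : E -> E) (linA : linear_on D A)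
  (S : R -> {linear E -> E}) (C0S : C0_semigroup S)
  (contrS : contraction_semigroup S) (cptS : compact_semigroup S)
  (genS : generates D A S)
  (f : R -> E -> E)
  (cf : {within `[a, b] `*` [set: E], continuous (fun p : R * E => f p.1 p.2)})
  (domf : L1_dominated a b f)
  (M : (R -> E) -> E)
  (extM : forall x y : R -> E, Cab a b x -> Cab a b y ->
     (forall t, t \in `[a, b] -> x t = y t) -> M x = M y)
  (r : R) (r0 : 0 < r)
  (m0 : forall x, Cab_ball a b r x -> `|M x| <= r)
  (m1 : forall (x_ : nat -> R -> E) (x : R -> E),
     (forall n, Cab_ball a b r (x_ n)) -> Cab a b x ->
     (forall t, t \in `]a, b] -> x_ n t @[n --> \oo] --> x t) ->
     M (x_ n) @[n --> \oo] --> M x)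
  (bV : exists V : E -> R, @locally_lipschitz R E R^o V /\
     bounding_function f a b (ball (0 : E) r) V) :
  exists x : R -> E,
    [/\ Cab_ball a b r x, mild_solution S f a b x & x a = M x].
Proof.
have [V [lipV bfV]] := bV; have ab' := ltW ab.
pose pi := @retraction R E r; pose F s x := f (clamp a b s) (pi x).
have cpi : continuous pi by exact: retraction_continuous.
have cF : continuous (fun p : R * E => F p.1 p.2).
  move=> p; pose q (p : R * E) : R * E := (clamp a b p.1, pi p.2).
  have cq : q x @[x --> p] --> q p.
    have c1 : x.1 @[x --> p] --> p.1 by exact: cvg_fst.
    have c2 : x.2 @[x --> p] --> p.2 by exact: cvg_snd.
    have H1 : clamp a b x.1 @[x --> p] --> clamp a b p.1.
      exact: (continuous_cvg _ (@clamp_continuous _ a b p.1) c1).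
    have H2 : pi x.2 @[x --> p] --> pi p.2.
      exact: (continuous_cvg _ (cpi p.2) c2).
    exact: cvg_pair H1 H2.
  have qin x : (`[a, b] `*` [set: E]) (q x).
    by split => //=; rewrite in_itv /=; exact: clamp_in.
  move: cf => /subspace_continuousP /(_ _ (qin p)) fq B /fq fqB.
  have := cq _ fqB; apply: (@filterS _ (nbhs p) (nbhs_filter p)) => x /(_ (qin x)).
  exact.
have bball : bounded_set [set x : E | `|x| <= r].
  exists r; split; first exact: num_real.
  by move=> y ry x /= xr; apply: le_trans xr (ltW ry).
have [nu inu domnu] := domf _ bball.
pose nu' s := `|nu s|.
have inu' : integrable_on a b nu' by exact: integrable_norm inu.
have dF : {ae @lebesgue_measure R, forall s, s \in `[a, b] ->
    forall x, `|F s x| <= nu' s}.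
  apply: (ae_imply _ domnu) => s H sab x; move: (sab); rewrite in_itv /= => sab'.
  rewrite /F clamp_id //; apply: le_trans (ler_norm _); apply: H => //.
  exact: retraction_le.
pose N (z : R -> E) := M (pi \o z).
have cpz z : continuous z -> Cab a b (pi \o z).
  move=> cz; apply: continuous_subspaceT => t.
  by apply: continuous_comp; [exact: cz | exact: cpi].
have ballz z : continuous z -> Cab_ball a b r (pi \o z).
  by move=> cz; split; [exact: cpz | move=> t _; exact: retraction_le].
have Nb z : continuous z -> `|N z| <= r by move=> cz; apply: m0; exact: ballz.
have Nc (z_ : nat -> R -> E) z : (forall n, continuous (z_ n)) -> continuous z ->
    (forall t, a < t <= b -> z_ n t @[n --> \oo] --> z t) ->
    N (z_ n) @[n --> \oo] --> N z.
  move=> cz_ cz zz; apply: m1 => [n||t]; [exact: ballz | exact: cpz |].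
  rewrite in_itv /= => tab; exact: (continuous_cvg _ (@cpi _) (zz t tab)).
have [z [cz zE]] := truncated_problem reflE C0S contrS cptS ab
  (fun s => normr_ge0 (nu s)) inu' cF dF Nb Nc.
pose g s := F s (z s).
have cg : continuous g by exact: nemytskii_continuous.
have zr t : a <= t <= b -> `|z t| <= r.
  apply: (mild_norm_bound reflE C0S contrS ab cg cz (Nb z cz) zE) => //.
  move=> s sab rs; have r1 : 0 < `|z s| by apply: lt_trans rs.
  have pir : `|pi (z s)| = r.
    rewrite /pi retraction_out ?ltW // normrZ gtr0_norm ?divr_gt0 // mulfVK //.
    by rewrite gt_eqF.
  have [c c0 cP] := bounding_function_outward r0 lipV bfV (sab : s \in `]a, b]) pir.
  exists c => // k k0.
  (* Outside the ball z s is a multiple of its retraction. *)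
  have zs : z s = (`|z s| / r) *: pi (z s).
    rewrite /pi retraction_out ?ltW // scalerA mulrA mulfVK ?gt_eqF //.
    by rewrite divff ?scale1r // gt_eqF.
  have -> : g s = f s (pi (z s)).
    by rewrite /g /F clamp_id //; case/andP: sab => /ltW -> ->.
  rewrite {1 2}zs; apply: (outward_scale _ pir) => //; exact: divr_gt0.
have piz t : a <= t <= b -> pi (z t) = z t.
  by move=> tab; apply: retraction_id => //; exact: zr.
have Mz : N z = M z.
  apply: extM; [exact: cpz | exact: continuous_subspaceT |].
  by move=> t; rewrite in_itv /=; exact: piz.
have za : z a = M z.
  rewrite zE ?lexx // subrr semigroup0 // Mz duhamel_refl ?addr0 //.
exists z; split => //.
  split; first exact: continuous_subspaceT.
  by move=> t; rewrite in_itv /=; exact: zr.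
split; first exact: continuous_subspaceT.
move=> t; rewrite in_itv /= => tab; have [ta tb] := andP tab.
exists (duhamel S g a t); last by rewrite zE // Mz za.
apply: vint_bochner => //; first exact: duhamel_integrand_continuous.
move=> s /andP[as_ st]; have sab : a <= s <= b by rewrite as_ (le_trans st).
by rewrite flowE ?subr_ge0 // /g /F clamp_id // piz.
Qed.
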